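(* Let $B_0$ be the boundary of an integral $1$-current in $\mathbb{R}^d$, represented as $$B_0=-\sum_{i=1}^{N_-}a_i\delta_{x_i}+\sum_{j=1}^{N_+}b_j\delta_{y_j},\qquad a_i,b_j\in\mathbb{N}.$$ Then $\mathscr{M}_{\mathbb{R}}(B_0)=\mathscr{M}_{\mathbb{Z}}(B_0)$.
   Context: Currents here are classical currents in $\mathbb{R}^d$ (real coefficients, Euclidean norm). $\mathbb{M}$ denotes mass, $\partial$ boundary, and $\delta_x$ the $0$-current given by the Dirac mass at $x$. A normal $1$-current is a $1$-current $T$ with $\mathbb{M}(T)+\mathbb{M}(\partial T)<\infty$; an integral $1$-current is a rectifiable $1$-current with integer multiplicity whose boundary is also rectifiable with integer multiplicity. Define $$\mathscr{M}_{\mathbb{R}}(B_0):=\min\{\mathbb{M}(T): T\text{ is a normal }1\text{-current in }\mathbb{R}^d,\ \partial T=B_0\},$$ $$\mathscr{M}_{\mathbb{Z}}(B_0):=\min\{\mathbb{M}(T): T\text{ is an integral }1\text{-current in }\mathbb{R}^d,\ \partial T=B_0\}.$$ *)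

(* Defs.v *)
Set Warnings "-notation-overridden,-ambiguous-paths".
From HB Require Import structures.
From mathcomp Require Import all_boot all_order all_algebra.
From mathcomp Require Import all_classical all_reals all_analysis.

Set Implicit Arguments.
Unset Strict Implicit.
Unset Printing Implicit Defensive.
Import Order.TTheory GRing.Theory Num.Theory.
Import numFieldNormedType.Exports.

Local Open Scope classical_set_scope.
Local Open Scope ring_scope.

(* The norm [`|x|] that the library puts on ['rV_d] is the sup norm. It induces
   the usual topology, and is used only for topological notions; lengths,
   diameters and comasses are Euclidean. *)

Section Euclidean.
Variables (R : realType) (d : nat).
Implicit Types u v : 'rV[R]_d.

Definition dotp u v : R := \sum_(i < d) u 0 i * v 0 i.

Definition enorm u : R := Num.sqrt (dotp u u).

End Euclidean.

Section TestFunctions.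
Variables (R : realType) (d : nat).
Notation E := 'rV[R]_d.
Implicit Types (f g : E -> R) (i : 'I_d) (s : seq 'I_d).

Definition partial i f : E -> R := fun x => 'D_(delta_mx 0 i : E) f x.

Definition partials s f : E -> R := foldr partial f s.

Definition smooth f := forall s,
  continuous (partials s f) /\
  forall i x, derivable (partials s f) x (delta_mx 0 i).

Definition test_function f :=
  smooth f /\ compact (closure [set x | f x != 0]).

Lemma partials_rcons s i f : partials (rcons s i) f = partials s (partial i f).
Proof. by rewrite /partials foldr_rcons. Qed.

Lemma partials_lin s (a : R) f g : smooth f -> smooth g ->
  partials s (a *: f + g) = a *: partials s f + partials s g.
Proof.
move=> sf sg; elim: s => //= i s ->; apply/funext => x.
have df := (sf s).2 i x; have dg := (sg s).2 i x.
rewrite {1}/partial deriveD//; last exact: derivableZ.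
by rewrite deriveZ.
Qed.

Lemma smooth_lin (a : R) f g : smooth f -> smooth g -> smooth (a *: f + g).
Proof.
move=> sf sg s; rewrite partials_lin//; split => [x|i x].
  apply: continuousD; last exact: (sg s).1.
  by apply: continuousZr; exact: (sf s).1.
apply: derivableD; last exact: (sg s).2.
by apply: derivableZ; exact: (sf s).2.
Qed.

Lemma partials_zero s : partials s (0 : E -> R) = 0.
Proof.
elim: s => //= i s ->; apply/funext => x.
exact: (derive_cst (0 : R)).
Qed.

Lemma test_function_submod_closed :
  submod_closed [pred f | `[< test_function f >]].
Proof.
split.
  apply/asboolP; split.
    move=> s; rewrite partials_zero; split=> [x|i x]; first exact: cst_continuous.
    exact: (derivable_cst (0 : R)).
  rewrite (_ : mkset _ = set0) ?closure0; first exact: compact0.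
  by apply/seteqP; split => x //=; rewrite eqxx.
move=> a f g /asboolP[sf cf] /asboolP[sg cg].
apply/asboolP; split; first exact: smooth_lin.
apply: (subclosed_compact _ (compactU cf cg)); first exact: closed_closure.
rewrite -closureU; apply: closureS => x /=.
have [fx0|/= ? _] := eqVneq (f x) 0; last by left.
have [gx0|/= ? _] := eqVneq (g x) 0; last by right.
by rewrite -[(_ + _) x]/(a * f x + g x) fx0 gx0 mulr0 addr0 eqxx.
Qed.

Lemma smooth_partial i f : smooth f -> smooth (partial i f).
Proof. by move=> sf s; rewrite -partials_rcons; exact: sf. Qed.

Lemma partial_support i f :
  [set x | partial i f x != 0] `<=` closure [set x | f x != 0].
Proof.
move=> x /=; apply: contraNP => ncl.
have : nbhs x (~` closure [set x | f x != 0]).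
  by apply: open_nbhs_nbhs; split => //; exact/closed_openC/closed_closure.
move=> nx; rewrite /partial (@near_eq_derive _ _ _ f (cst 0)).
  by rewrite derive_cst.
apply: filterS nx => y; apply: contra_notP => /eqP fy.
exact: subset_closure.
Qed.

Lemma test_function_partial i f :
  test_function f -> test_function (partial i f).
Proof.
move=> [sf cf]; split; first exact: smooth_partial.
apply: (subclosed_compact _ cf); first exact: closed_closure.
rewrite [X in _ `<=` X](_ : _ = closure (closure [set x | f x != 0])).
  exact/closureS/partial_support.
exact/closure_id/closed_closure.
Qed.

End TestFunctions.

(* Smooth compactly supported functions. *)
Record testfun (R : realType) (d : nat) := TestFun {
  testfun_fun :> 'rV[R]_d -> R ;
  testfun_subproof : testfun_fun \in [pred f | `[< test_function f >]] }.

Section TestFunLmod.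
Variables (R : realType) (d : nat).

HB.instance Definition _ := [isSub for @testfun_fun R d].
HB.instance Definition _ := [Choice of testfun R d by <:].
HB.instance Definition _ := GRing.isSubmodClosed.Build _ _
  [pred f : 'rV[R]_d -> R | `[< test_function f >]]
  (@test_function_submod_closed R d).
HB.instance Definition _ := [SubChoice_isSubLmodule of testfun R d by <:].

Lemma testfunP (f : testfun R d) : test_function f.
Proof. by case: f => f /= /asboolP. Qed.

Definition dpartial (i : 'I_d) (f : testfun R d) : testfun R d :=
  TestFun (asboolT (test_function_partial i (testfunP f))).

(* [w i] is the coefficient of dx_i in the 1-form w. *)
Definition form1 := {ffun 'I_d -> testfun R d}.

Definition form1_at (w : form1) (x : 'rV[R]_d) : 'rV[R]_d := \row_i w i x.

Definition ext_d (f : testfun R d) : form1 := [ffun i => dpartial i f].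

Lemma ext_d_linear : linear ext_d.
Proof.
move=> a f g; apply/ffunP => i; rewrite !ffunE; apply/val_inj => /=.
have := @partials_lin R d [:: i] a f g (testfunP f).1 (testfunP g).1.
by [].
Qed.

HB.instance Definition _ :=
  GRing.isLinear.Build R (testfun R d) form1 *:%R ext_d ext_d_linear.

End TestFunLmod.

Section Currents.
Variables (R : realType) (d : nat).
Notation E := 'rV[R]_d.
Local Open Scope ereal_scope.
Local Open Scope ring_scope.

(* Continuity for the usual LF-topology of the space of test forms, in terms of
   seminorm estimates on the forms supported in a given compact set. *)
Definition continuous0 (T : testfun R d -> R) := forall K : set E, compact K ->
  exists (N : nat) (C : R), forall (f : testfun R d) (M : R),
    (forall x, ~ K x -> f x = 0) ->
    (forall (s : seq 'I_d) x, (size s <= N)%N -> `|partials s f x| <= M) ->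
    `|T f| <= C * M.

Definition continuous1 (T : form1 R d -> R) := forall K : set E, compact K ->
  exists (N : nat) (C : R), forall (w : form1 R d) (M : R),
    (forall i x, ~ K x -> w i x = 0) ->
    (forall (s : seq 'I_d) i x, (size s <= N)%N -> `|partials s (w i) x| <= M) ->
    `|T w| <= C * M.

Record current0 := Current0 {
  current0_fun :> {scalar testfun R d} ;
  current0_continuous : continuous0 current0_fun }.

Record current1 := Current1 {
  current1_fun :> {scalar form1 R d} ;
  current1_continuous : continuous1 current1_fun }.

Lemma current0_ext (S T : current0) : (forall f, S f = T f) -> S = T.
Proof.
case: S T => [S cS] [T cT] /= ST.
have {}ST : S = T.
  case: S T ST {cS cT} => [S [[hS1] [hS2]]] [T [[hT1] [hT2]]] /= ST.
  have {}ST : S = T by apply/funext.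
  case: T / ST hT1 hT2 => hT1 hT2.
  by rewrite (Prop_irrelevance hS1 hT1) (Prop_irrelevance hS2 hT2).
by case: T / ST cT => cT; rewrite (Prop_irrelevance cS cT).
Qed.

Definition dirac_fun (p : E) (f : testfun R d) : R := f p.

Lemma dirac_linear p : scalar (dirac_fun p).
Proof. by []. Qed.

HB.instance Definition _ p :=
  GRing.isLinear.Build R (testfun R d) R *%R (dirac_fun p) (dirac_linear p).

Lemma dirac_continuous p : continuous0 (dirac_fun p).
Proof.
move=> K _; exists 0%N, 1 => f M _ fM; rewrite mul1r.
exact: (fM [::]).
Qed.

Definition delta (p : E) : current0 := Current0 (@dirac_continuous p).

Definition boundary_fun (T : current1) (f : testfun R d) : R := T (ext_d f).

Lemma boundary_linear T : scalar (boundary_fun T).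
Proof. by move=> a f g; rewrite /boundary_fun !linearP. Qed.

HB.instance Definition _ T := GRing.isLinear.Build R (testfun R d) R *%R
  (boundary_fun T) (boundary_linear T).

Lemma boundary_continuous T : continuous0 (boundary_fun T).
Proof.
move=> K cK; have [N [C NC]] := current1_continuous T cK.
exists N.+1, C => f M fK fM; apply: NC => [i x nKx|s i x sN]; rewrite ffunE.
  have clK : closure [set x | f x != 0] `<=` K.
    have /closure_id clKE : closed K by exact: compact_closed.
    rewrite [X in _ `<=` X]clKE.
    apply: closureS => y /= fy; apply: contrapT => /fK fy0.
    by rewrite fy0 eqxx in fy.
  by apply/eqP; apply: contra_notT nKx => /partial_support /clK.
by have := fM (rcons s i) x; rewrite size_rcons partials_rcons; exact.
Qed.

Definition boundary (T : current1) : current0 :=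
  Current0 (@boundary_continuous T).

Definition mass0 (T : current0) : \bar R :=
  ereal_sup [set (T f)%:E | f in [set f : testfun R d |
    forall x, `|f x| <= 1]].

Definition mass1 (T : current1) : \bar R :=
  ereal_sup [set (T w)%:E | w in [set w : form1 R d |
    forall x, enorm (form1_at w x) <= 1]].

Definition normal (T : current1) := (mass1 T + mass0 (boundary T) < +oo)%E.

End Currents.

Section Hausdorff.
Variables (R : realType) (d : nat).
Notation E := 'rV[R]_d.
Local Open Scope ereal_scope.

(* 0 is added so that the empty set has diameter 0, and not -oo. *)
Definition diam (A : set E) : \bar R :=
  ereal_sup (0 |` [set (enorm (x - y))%:E | x in A & y in A]).

Lemma diam_ge0 A : 0 <= diam A.
Proof. by apply: ereal_sup_ubound; left. Qed.

Lemma diam0 : diam set0 = 0.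
Proof.
rewrite /diam (_ : _ |` _ = [set 0]) ?ereal_sup1//.
by apply/seteqP; split => [_ [->//|[x []]]|_ ->]; left.
Qed.

Definition fine_cover (delta : R) (A : set E) := [set F : (set E)^nat |
  (forall k, diam (F k) <= delta%:E) /\ A `<=` \bigcup_k F k].

Definition hausdorff1_pre (delta : R) (A : set E) : \bar R :=
  ereal_inf [set \sum_(k <oo) diam (F k) | F in fine_cover delta A].

Definition hausdorff1 (A : set E) : \bar R :=
  ereal_sup [set hausdorff1_pre delta A | delta in [set r : R | (0 < r)%R]].

Lemma hausdorff1_pre_ge0 delta A : 0 <= hausdorff1_pre delta A.
Proof.
apply: le_ereal_inf_tmp => _ [F _ <-]; apply: nneseries_ge0 => k _ _.
exact: diam_ge0.
Qed.

Lemma hausdorff1_ge0 A : 0 <= hausdorff1 A.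
Proof.
apply: le_trans (hausdorff1_pre_ge0 1 A) _.
by apply: ereal_sup_ubound; exists 1%R => //=.
Qed.

Lemma hausdorff1_0 : hausdorff1 set0 = 0.
Proof.
apply/eqP; rewrite eq_le hausdorff1_ge0 andbT.
apply: ge_ereal_sup => _ [r /= r0 <-].
apply: ereal_inf_lbound; exists (fun=> set0).
  by split => // k; rewrite diam0 lee_fin ltW.
by apply: eseries0 => k _ _; exact: diam0.
Qed.

Lemma le_hausdorff1_pre delta :
  {homo hausdorff1_pre delta : A B / A `<=` B >-> A <= B}.
Proof.
move=> A B AB; apply: ereal_inf_le_tmp => _ [F [Fd BF] <-].
by exists F => //; split => //; exact: subset_trans BF.
Qed.

Lemma le_hausdorff1 : {homo hausdorff1 : A B / A `<=` B >-> A <= B}.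
Proof.
move=> A B AB; apply: ge_ereal_sup => _ [r r0 <-].
apply: le_trans (le_hausdorff1_pre r AB) _.
by apply: ereal_sup_ubound; exists r.
Qed.

Lemma hausdorff1_pre_sigma_subadditive delta :
  sigma_subadditive (hausdorff1_pre delta).
Proof.
set mu := hausdorff1_pre delta.
have mu0 := hausdorff1_pre_ge0 delta.
move=> A; have [[i ioo]|] := pselect (exists i, mu (A i) = +oo).
  rewrite (eseries_pinfty _ _ ioo) ?leey// => n _.
  by rewrite -ltNye (lt_le_trans _ (mu0 _)).
rewrite -forallNE => Aoo.
suff add2e (e : {posnum R}) :
    mu (\bigcup_n A n) <= \sum_(i <oo) mu (A i) + e%:num%:E.
  by apply/lee_addgt0Pr => _/posnumP[].
rewrite (le_trans _ (epsilon_trick _ _ _))//.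
pose P n (B : (set E)^nat) := fine_cover delta (A n) B /\
  \sum_(k <oo) diam (B k) <= mu (A n) + (e%:num / (2 ^ n.+1)%:R)%:E.
have [G PG] : {G : ((set E)^nat)^nat & forall n, P n (G n)}.
  apply: (@choice _ _ P) => n; rewrite /P.
  have fA : mu (A n) \is a fin_num.
    by rewrite ge0_fin_numE// ltey; apply/eqP/Aoo.
  have en1 : (0 < e%:num / (2 ^ n.+1)%:R)%R by [].
  have [_ [B AB <-] muB] := lb_ereal_inf_adherent en1 fA.
  by exists B; split => //; exact/ltW.
have diamG_ge0 x : 0 <= (diam \o uncurry G) x by exact: diam_ge0.
apply: (@le_trans _ _ (\esum_(i in setT) (diam \o uncurry G) i)).
  apply: ereal_inf_lbound => /=.
  have /card_esym/ppcard_eqP[f] := card_nat2.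
  exists (uncurry G \o f).
    split => [i|].
      by rewrite /= /uncurry; case: (f i) => a b; exact: (PG a).1.1.
    apply: (@subset_trans _  (\bigcup_n \bigcup_k G n k)) => [t [i _]|].
      by move=> /((PG i).1.2) -[j _ ?]; exists i => //; exists j.
    move=> t [i _ [j _ Bijt]]; exists (f^-1%FUN (i, j)) => //=.
    by rewrite invK ?inE.
  rewrite -(esum_pred_image (diam \o uncurry G) _ xpredT) ?[fun=> _]set_true//.
  by rewrite image_eq.
rewrite (_ : esum _ _ = \sum_(i <oo) \sum_(j <oo ) diam (G i j)); last first.
  pose J : nat -> set (nat * nat) := fun i => [set (i, j) | j in setT].
  rewrite (_ : setT = \bigcup_k J k); last first.
    by rewrite predeqE => -[a b]; split => // _; exists a => //; exists b.
  rewrite esum_bigcupT /=; last 2 first.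
    - apply/trivIsetP => i j _ _ ij.
      rewrite predeqE => -[n m] /=; split => //= -[] [_] _ [<-{n} _].
      by move=> [m' _] [] /esym/eqP; rewrite (negbTE ij).
    - by move=> /= [n m]; exact: diam_ge0.
  rewrite -(image_id [set: nat]) -fun_true esum_pred_image//; last first.
    by move=> n _; apply: esum_ge0 => x _; exact: diamG_ge0.
  apply: eq_eseriesr => /= j _.
  rewrite -(esum_pred_image (diam \o uncurry G) (pair j) predT); last 2 first.
    - by move=> n _; exact: diamG_ge0.
    - by move=> ? ? _ _; exact: (@can_inj _ _ _ snd).
  by congr esum; rewrite predeqE => -[a b]; split; move=> [i _ <-]; exists i.
apply: lee_nneseries => [n _ _|n _]; last exact: (PG n).2.
by apply: nneseries_ge0 => m _ _; exact: diam_ge0.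
Qed.

Lemma hausdorff1_sigma_subadditive : sigma_subadditive hausdorff1.
Proof.
move=> A; apply: ge_ereal_sup => _ [r r0 <-].
apply: le_trans (hausdorff1_pre_sigma_subadditive r A) _.
apply: lee_nneseries => [n _ _|n _]; first exact: hausdorff1_pre_ge0.
by apply: ereal_sup_ubound; exists r.
Qed.

HB.instance Definition _ := isOuterMeasure.Build R E hausdorff1
  hausdorff1_0 hausdorff1_ge0 le_hausdorff1 hausdorff1_sigma_subadditive.

End Hausdorff.

Section Integral.
Variables (R : realType) (d : nat).
Notation E := 'rV[R]_d.

Definition hausdorff1_outer : {outer_measure set E -> \bar R} :=
  @hausdorff1 R d.

Definition h1space := caratheodory_type hausdorff1_outer.

Definition H1 : {measure set h1space -> \bar R} := hausdorff1_outer.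

Definition rectifiable_set (A : set E) :=
  exists gamma : nat -> R -> E,
    (forall k, lipschitz (gamma k)) /\
    hausdorff1 (A `\` \bigcup_k range (gamma k)) = 0%E.

(* At almost all x in A, tau x spans the approximate tangent line of A, i.e.
   the tangent line of every Lipschitz curve at almost all points of A that it
   visits. *)
Definition orients (A : set E) (tau : E -> E) :=
  (forall x, A x -> enorm (tau x) = 1) /\
  forall gamma : R -> E, lipschitz gamma ->
    hausdorff1 [set x | A x /\ exists t : R,
      [/\ gamma t = x, derivable gamma t 1, 'D_1 gamma t != 0 &
          forall c : R, 'D_1 gamma t != c *: tau x]] = 0%E.

Definition integer_rectifiable1 (T : current1 R d) :=
  exists (A : set h1space) (tau : h1space -> E) (theta : h1space -> int),
    [/\ measurable A, rectifiable_set A,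
        orients A tau /\
          (forall i, measurable_fun A (fun x => tau x 0 i)),
        H1.-integrable A (fun x => (theta x)%:~R%:E) &
        forall w : form1 R d,
          T w = \int[H1]_(x in A) (dotp (form1_at w x) (tau x) * (theta x)%:~R)].

(* An integer multiplicity that is summable for the counting measure vanishes
   off a finite set. *)
Definition integer_rectifiable0 (T : current0 R d) :=
  exists (n : nat) (p : 'I_n -> E) (theta : 'I_n -> int),
    forall f, T f = \sum_(i < n) (theta i)%:~R * delta (p i) f.

Definition integral_current (T : current1 R d) :=
  integer_rectifiable1 T /\ integer_rectifiable0 (boundary T).

Definition normal_masses (B : current0 R d) : set (\bar R) :=
  [set mass1 T | T in [set T | normal T /\ boundary T = B]].

Definition integral_masses (B : current0 R d) : set (\bar R) :=
  [set mass1 T | T in [set T | integral_current T /\ boundary T = B]].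

Definition M_R (B : current0 R d) : \bar R := ereal_inf (normal_masses B).

Definition M_Z (B : current0 R d) : \bar R := ereal_inf (integral_masses B).

End Integral.

(* Main.v *)
Require Import Defs.
Set Warnings "-notation-overridden,-ambiguous-paths".
From HB Require Import structures.
From mathcomp Require Import all_boot all_order all_algebra.
From mathcomp Require Import all_classical all_reals all_analysis.
From mathcomp Require Import measurable_realfun perm ring lra.
Import numFieldNormedType.Exports.
Local Open Scope classical_set_scope.
Local Open Scope ring_scope.
Import Order.TTheory GRing.Theory Num.Theory.
Set Implicit Arguments.
Unset Strict Implicit.
Unset Printing Implicit Defensive.

(* Testing a filling of [B0] against truncated cones of arbitrary height shows
   that [B0] has total charge zero, so it is a difference of [N] sources and [N]
   sinks, counted with multiplicity. Let [W] be the least total length of a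
   matching of sources with sinks. The sum of the segments of an optimal matching
   is an integral current of mass at most [W]. Conversely, optimality of the
   matching excludes negative cycles, so shortest paths yield potentials and from
   them a 1-Lipschitz function [u] with [B0 u = W] (Kantorovich duality). A
   log-sum-exp regularization of [u], composed with a smooth positive part, is a
   test function whose gradient has norm at most 1, so every current with
   boundary [B0] has mass at least [W]. Both infima are thus attained and equal
   to [W]. *)

(** * Euclidean norm and optimal matchings *)

(** Test functions have compact support, so a boundary can be tested neither against the constant 1
    nor against a distance. This is why neutrality of [B0] needs an argument, and why potentials are
    lifted by a constant before their positive part is taken: only differences of values matter, and
    the lift and the defect of the soft positive part cancel in them. On the integral side the
    obstacle is the encoding of a rectifiable current by one carrier, one unit orientation and one
    integer multiplicity, while the segments of a matching may overlap or run in opposite directions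
    on one line. Segments are added one at a time: a null set is discarded, the old orientation is
    kept on the overlap, and the multiplicity is corrected by a sign. As [H1] comes from an outer
    measure on Caratheodory sets, this rests on measurability of open sets and on [H1] being length
    on lines. Cancellation can only lower the mass, so for the sum of segments only an upper bound
    is proved; equality comes from duality. *)

Section EuclideanNorm.
Variables (R : realType) (d : nat).
Implicit Types u v w : 'rV[R]_d.

Lemma dotpC u v : dotp u v = dotp v u.
Proof. by apply: eq_bigr => i _; rewrite mulrC. Qed.

Lemma dotpDl u v w : dotp (u + v) w = dotp u w + dotp v w.
Proof. by rewrite -big_split; apply: eq_bigr => i _; rewrite mxE mulrDl. Qed.

Lemma dotpZl c u v : dotp (c *: u) v = c * dotp u v.
Proof. by rewrite /dotp mulr_sumr; apply: eq_bigr => i _; rewrite mxE mulrA. Qed.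

Lemma dotpDr u v w : dotp u (v + w) = dotp u v + dotp u w.
Proof. by rewrite !(dotpC u) dotpDl. Qed.

Lemma dotpZr c u v : dotp u (c *: v) = c * dotp u v.
Proof. by rewrite !(dotpC u) dotpZl. Qed.

Lemma dotpBl u v w : dotp (u - v) w = dotp u w - dotp v w.
Proof. by rewrite dotpDl -scaleN1r dotpZl mulN1r. Qed.

Lemma dotpNl u w : dotp (- u) w = - dotp u w.
Proof. by rewrite -scaleN1r dotpZl mulN1r. Qed.

Lemma dotp0l u : dotp 0 u = 0.
Proof. by rewrite /dotp big1// => i _; rewrite mxE mul0r. Qed.

Lemma dotp_ge0 u : 0 <= dotp u u.
Proof. by apply: sumr_ge0 => i _; exact: sqr_ge0. Qed.

Lemma enorm_ge0 u : 0 <= enorm u.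
Proof. exact: sqrtr_ge0. Qed.

Lemma sqr_enorm u : enorm u ^+ 2 = dotp u u.
Proof. by rewrite sqr_sqrtr ?dotp_ge0. Qed.

Lemma enorm0 : enorm (0 : 'rV[R]_d) = 0.
Proof. by rewrite /enorm dotp0l sqrtr0. Qed.

Lemma enormZ c u : enorm (c *: u) = `|c| * enorm u.
Proof.
by rewrite /enorm dotpZl dotpZr mulrA -expr2 sqrtrM ?sqr_ge0// sqrtr_sqr.
Qed.

Lemma enormN u : enorm (- u) = enorm u.
Proof. by rewrite -scaleN1r enormZ normrN1 mul1r. Qed.

Lemma enormB u v : enorm (u - v) = enorm (v - u).
Proof. by rewrite -enormN opprB. Qed.

Lemma normr_coord_le_enorm u i : `|u 0 i| <= enorm u.
Proof.
rewrite -(ler_pXn2r (n := 2)) ?nnegrE ?enorm_ge0// sqr_enorm.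
rewrite real_normK ?num_real// /dotp (bigD1 i)//= -expr2 lerDl.
by apply: sumr_ge0 => j _; exact: sqr_ge0.
Qed.

Lemma enorm_eq0 u : (enorm u == 0) = (u == 0).
Proof.
apply/eqP/eqP => [u0|->]; last exact: enorm0.
apply/rowP => i; rewrite mxE; apply/eqP; rewrite -normr_le0 -u0.
exact: normr_coord_le_enorm.
Qed.

Lemma mx_norm_le_enorm u : `|u| <= enorm u.
Proof.
rewrite /Num.norm/= mx_normrE; apply: bigmax_le; first exact: enorm_ge0.
by move=> [i j] _ /=; rewrite ord1; exact: normr_coord_le_enorm.
Qed.

Lemma Cauchy_Schwarz_dotp u v : `|dotp u v| <= enorm u * enorm v.
Proof.
have [->|v0] := eqVneq v 0.
  by rewrite dotpC dotp0l normr0 mulr_ge0 ?enorm_ge0.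
have v2_gt0 : 0 < dotp v v.
  by rewrite -sqr_enorm exprn_gt0// lt_neqAle eq_sym enorm_eq0 v0 enorm_ge0.
rewrite -(ler_pXn2r (n := 2)) ?nnegrE ?mulr_ge0 ?enorm_ge0//.
rewrite real_normK ?num_real// exprMn !sqr_enorm.
have := dotp_ge0 (dotp v v *: u - dotp u v *: v).
rewrite dotpBl !dotpZl (dotpC u) (dotpC v (_ - _)) !dotpBl !dotpZl (dotpC v u).
have -> : dotp v v * (dotp v v * dotp u u - dotp u v * dotp u v) -
  dotp u v * (dotp v v * dotp u v - dotp u v * dotp v v) =
  dotp v v * (dotp u u * dotp v v - dotp u v ^+ 2) by ring.
by rewrite pmulr_rge0// subr_ge0.
Qed.

Lemma enormD u v : enorm (u + v) <= enorm u + enorm v.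
Proof.
rewrite -(ler_pXn2r (n := 2)) ?nnegrE ?addr_ge0 ?enorm_ge0//.
rewrite sqrrD !sqr_enorm dotpDl !dotpDr (dotpC v u).
have := le_trans (ler_norm _) (Cauchy_Schwarz_dotp u v).
lra.
Qed.

Lemma enorm_sum (I : Type) (r : seq I) (P : pred I) (F : I -> 'rV[R]_d) :
  enorm (\sum_(i <- r | P i) F i) <= \sum_(i <- r | P i) enorm (F i).
Proof.
elim/big_ind2: _ => [|u x v y ux vy|//]; first by rewrite enorm0.
exact: le_trans (enormD _ _) (lerD ux vy).
Qed.

End EuclideanNorm.

(** * The assignment problem and its dual *)

Section OptimalMatching.
Variables (R : realType) (n : nat).
Notation I := 'I_n.

Fixpoint walk_weight (w : I -> I -> R) (i : I) (s : seq I) : R :=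
  if s is j :: s' then w i j + walk_weight w j s' else 0.

Lemma walk_weight_cat w i s t :
  walk_weight w i (s ++ t) = walk_weight w i s + walk_weight w (last i s) t.
Proof. by elim: s i => [|j s IH] i /=; rewrite ?add0r// IH addrA. Qed.

Lemma walk_weight_cycle (w : I -> I -> R) i s :
  uniq (i :: s) ->
  walk_weight w i (rcons s i) = \sum_(k <- i :: s) w k (next (i :: s) k).
Proof.
move=> us.
(* The closing point [b] is decoupled from the head of the walk, so that the induction can move the
   head forward. *)
suff H (a : I) t : uniq (a :: t) -> forall b, b \notin a :: t \/ b = i ->
    walk_weight w a (rcons t b) = \sum_(k <- a :: t) w k (next_at k b a t).
  rewrite (H _ _ us i (or_intror erefl)); apply: eq_big_seq => k ks.
  by [].
elim: t a {us} => [|c t IH] a /=.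
  by move=> _ b _; rewrite big_seq1 eqxx addr0.
rewrite inE negb_or -andbA => /and4P[ac at_ ct ut] b bP.
rewrite IH/= ?ct//; last first.
  by case: bP => [|->]; [rewrite !inE !negb_or => /and3P[_ -> ->]; left|right].
rewrite [in RHS]big_cons eqxx; congr (_ + _).
apply: eq_big_seq => k kct; case: eqVneq => // ka.
by move: kct; rewrite ka inE (negPf ac) (negPf at_).
Qed.

(* A cycle is a permutation, so the absence of negative permutations means that
   shortest walks may be taken simple; [f i] is the least weight of a simple
   walk starting from [i]. *)
Lemma exists_potential (w : I -> I -> R) :
  (forall s : 'S_n, \sum_i w i (s i) >= 0) -> (forall i, w i i = 0) ->
  exists f : I -> R, forall i j, f i <= w i j + f j.
Proof.
move=> w_ge0 w0.
have cyc_ge0 i s : uniq (i :: s) -> 0 <= walk_weight w i (rcons s i).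
  move=> us; rewrite walk_weight_cycle//.
  have /(_ (perm (can_inj (prev_next us)))) := w_ge0.
  rewrite (bigID (mem (i :: s)))/= [X in _ + X]big1 ?addr0.
    rewrite big_uniq//= => /le_trans; apply.
    by apply: ler_sum => k _; rewrite permE.
  by move=> k ks; rewrite permE next_nth (negPf ks) w0.
have [f fP] : {f : I -> R & forall i,
    (exists2 s, uniq (i :: s) & f i = walk_weight w i s) /\
    forall s, uniq (i :: s) -> f i <= walk_weight w i s}.
  apply: (@choice _ _ (fun i x => (exists2 s, uniq (i :: s) &
    x = walk_weight w i s) /\ forall s, uniq (i :: s) -> x <= walk_weight w i s)).
  (* A simple walk from [i] visits at most [n] further indices, so simple walks embed into a finite
     type of tuples, on which a minimum exists. *)
  move=> i; pose T := {k : 'I_n.+1 & k.-tuple I}.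
  pose wt (t : T) := walk_weight w i (tagged t).
  have P0 : uniq (i :: tagged (Tagged (fun k : 'I_n.+1 => k.-tuple I)
    (nil_tuple I : (ord0 : 'I_n.+1).-tuple I))) by [].
  case: (@arg_minP _ R T (Tagged (fun k : 'I_n.+1 => k.-tuple I)
    (nil_tuple I : (ord0 : 'I_n.+1).-tuple I))
    (fun t => uniq (i :: tagged t)) wt P0) => t ut tmin.
  exists (wt t); split; first by exists (tagged t).
  move=> s us; have ss : (size s < n.+1)%N.
    rewrite ltnS -[n in (_ <= n)%N]card_ord.
    by case/andP: us => _ /card_uniqP <-; exact: max_card.
  exact: (tmin (Tagged (fun k : 'I_n.+1 => k.-tuple I)
    (in_tuple s : (Ordinal ss).-tuple I))).
exists f => i j; have [[s us ->] _] := fP j; have [_ fi] := fP i.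
have [iNs|ijs] := boolP (i \notin j :: s).
  by apply: (fi (j :: s)); rewrite cons_uniq iNs.
(* When the optimal walk from [j] already meets [i], prefixing it by [i] closes a cycle, of
   nonnegative weight, followed by a simple walk from [i]. *)
have [s1 [s2 js]] : exists s1 s2, j :: s = s1 ++ i :: s2.
  by move: ijs; rewrite negbK => /splitPr[s1 s2]; exists s1, s2.
have -> : w i j + walk_weight w j s = walk_weight w i (rcons s1 i) +
    walk_weight w i s2.
  by rewrite -[LHS]/(walk_weight w i (j :: s)) js -cat_rcons walk_weight_cat last_rcons.
move: us; rewrite js cat_uniq /= => /and3P[us1 /norP[is1 _] us2].
rewrite -[leLHS]add0r lerD//; last exact: fi.
by apply: cyc_ge0; rewrite /= is1.
Qed.

Lemma exists_min_perm (c : I -> I -> R) : exists s : 'S_n,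
  forall t : 'S_n, \sum_i c i (s i) <= \sum_i c i (t i).
Proof.
case: (@arg_minP _ R 'S_n 1%g xpredT (fun s => \sum_i c i (s i)) isT) => s _ sP.
by exists s => t; exact: sP.
Qed.

(** Reassigning source [i] from sink [i] to sink [j] costs [c i j - c i i]. Optimality of the
    identity says that no permutation has negative total cost, so a potential exists; its opposite
    is the dual variable of the assignment problem. *)
Lemma exists_dual_potential (c : I -> I -> R) :
  (forall t : 'S_n, \sum_i c i i <= \sum_i c i (t i)) ->
  exists g : I -> R, forall i j, g j - c i j <= g i - c i i.
Proof.
move=> cmin.
have [s|i|f fP] := @exists_potential (fun i j => c i j - c i i).
- by rewrite sumrB subr_ge0.
- by rewrite subrr.
by exists (fun i => - f i) => i j; have := fP i j; lra.
Qed.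

End OptimalMatching.

(** * Smooth functions *)

Section DirectionalDerivative.
Variables (R : realType) (V : normedModType R).
Implicit Types (f : V -> R) (x v : V).

(** The two difference quotients coincide. One-variable results (chain rule, mean value theorem)
    thus apply to directional derivatives without Frechet differentiability. *)
Lemma is_derive_line f x v (t b : R) :
  is_derive t 1 (fun s => f (x + s *: v)) b <-> is_derive (x + t *: v) v f b.
Proof.
have E (h : R) : h^-1 *: (((fun s => f (x + s *: v)) \o shift t) (h *: 1)
      - f (x + t *: v)) =
    h^-1 *: ((f \o shift (x + t *: v)) (h *: v) - f (x + t *: v)).
  by rewrite /= -[h *: 1]/(h * 1) mulr1 scalerDl addrCA.
have D : derivable (fun s : R => f (x + s *: v)) t 1 = derivable f (x + t *: v) v.
  apply: (congr1 (fun F : R -> R => cvg (F @ 0^'))); apply/funext => h; exact: E.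
have D' : 'D_1 (fun s : R => f (x + s *: v)) t = 'D_v f (x + t *: v).
  apply: (congr1 (fun F : R -> R => lim (F @ 0^'))); apply/funext => h; exact: E.
split=> -[df <-].
  by split; [rewrite -D|rewrite -D'].
by split; [rewrite D|rewrite D'].
Qed.

Lemma is_derive_comp1 (phi : R -> R) f x v (a b : R) :
  is_derive (f x) 1 phi a -> is_derive x v f b ->
  is_derive x v (phi \o f) (a * b).
Proof.
have x0 : x = x + 0 *: v by rewrite scale0r addr0.
move=> dphi df; rewrite x0; apply/is_derive_line.
apply: (@is_derive1_comp R phi (fun s => f (x + s *: v))); first by rewrite -x0.
by apply/is_derive_line; rewrite -x0.
Qed.

End DirectionalDerivative.

(** * Functions flat at the origin and the soft positive part *)

Section Flat.
Variable R : realType.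
Implicit Types (p : {poly R}) (s : R).

(** All derivatives of [exp (- 1 / s)], extended by 0, are a polynomial in [1 / s] times the same
    exponential; carrying the polynomial as a parameter makes the family closed under derivation. *)
Definition flat p s : R := if 0 < s then p.[s^-1] * expR (- s^-1) else 0.

Lemma exprn_le_expR n (r : R) : 0 <= r -> r ^+ n <= n`!%:R * expR r.
Proof.
move=> r0; case: n => [|n].
  by rewrite expr0 fact0 mul1r (le_trans _ (expR_ge1Dx r))// lerDl.
rewrite mulrC -ler_pdivrMr ?ltr0n ?fact_gt0//.
by apply: le_trans (expR_ge1Dxn n r0); rewrite lerDr.
Qed.

(** Apply [r ^ (i + 2) <= (i + 2)! * exp r] at [r = 1 / s] to each monomial. Order 2 is what makes
    the derivative at 0 vanish. *)
Lemma flat_quadratic p : exists2 C, 0 <= C & forall s, `|flat p s| <= C * s ^+ 2.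
Proof.
exists (\sum_(i < size p) `|p`_i| * (i.+2)`!%:R) => [|s].
  by apply: sumr_ge0 => i _; rewrite mulr_ge0.
rewrite /flat; case: ifPn => [s0|_]; last first.
  rewrite normr0 mulr_ge0 ?sqr_ge0//.
  by apply: sumr_ge0 => i _; rewrite mulr_ge0.
rewrite horner_coef normrM (gtr0_norm (expR_gt0 _)) expRN.
rewrite ler_pdivrMr ?expR_gt0// -mulrA mulr_suml.
apply: le_trans (ler_norm_sum _ _ _) (ler_sum _ _) => i _.
rewrite normrM -mulrA ler_wpM2l//.
rewrite mulrCA -ler_pdivrMl ?exprn_gt0// ger0_norm ?exprn_ge0 ?invr_ge0 ?(ltW s0)//.
rewrite -exprVn -exprD add2n; apply: exprn_le_expR.
by rewrite invr_ge0 ltW.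
Qed.

Lemma is_derive_quadratic (phi : R -> R) (C : R) : 0 <= C ->
  (forall s, `|phi s| <= C * s ^+ 2) -> is_derive (0 : R) 1 phi 0.
Proof.
move=> C0 phiC.
have phi0 : phi 0 = 0.
  by apply/eqP; rewrite -normr_le0 (le_trans (phiC 0))// expr0n mulr0.
suff H : (fun h : R => h^-1 *: ((phi \o shift 0) (h *: (1 : R)) - phi 0)) @ 0^' --> 0.
  by split; [apply/cvg_ex; exists 0|exact/cvg_lim].
apply/cvgr0Pnorm_lt => e e0.
near=> h.
rewrite /= phi0 subr0 addr0 -[h *: (1 : R)]/(h * 1) mulr1 normrZ normfV.
have h0 : 0 < `|h| by rewrite normr_gt0; near: h; exact: nbhs_dnbhs_neq.
rewrite ltr_pdivrMl//; apply: le_lt_trans (phiC _) _.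
rewrite -real_normK ?num_real// expr2 mulrA [ltRHS]mulrC ltr_pM2r//.
have : `|h| < e / (C + 1).
  near: h; apply: dnbhs0_lt; rewrite divr_gt0// ltr_wpDl//.
rewrite ltr_pdivlMr ?ltr_wpDl// => /(le_lt_trans _); apply.
by rewrite mulrC ler_wpM2l// lerDl.
Unshelve. all: by end_near. Qed.

(** With [r = 1 / s] the derivative of [r] is [- r ^ 2], whence the polynomial [(p - p') X ^ 2]. *)
Lemma is_derive_flat p s : is_derive s 1 (flat p) (flat ((p - p^`()) * 'X^2) s).
Proof.
have [s0|s0|->] := ltgtP s 0.
- rewrite [X in is_derive _ _ _ X]/flat ltNge (ltW s0)/=.
  apply: (@near_eq_is_derive R R R (cst 0)).
  by near=> t; rewrite /flat ltNge ltW//; near: t; exact: lt_nbhsl.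
- rewrite [X in is_derive _ _ _ X]/flat s0.
  apply: (@near_eq_is_derive R R R
    ((horner p \o @GRing.inv R) * (@expR R \o (- @GRing.inv R)))).
    by near=> t; rewrite /flat ifT//; near: t; exact: lt_nbhsr.
  have sN0 : (id s : R) != 0 by rewrite gt_eqF.
  have dV : is_derive s 1 (fun t : R => t^-1) (- s ^- 2 *: 1).
    exact: (is_deriveV sN0).
  have dp := is_derive1_comp (is_derive_poly p s^-1) dV.
  have de := is_derive_comp1 (is_derive_expR ((- (fun t : R => t^-1)) s)) (is_deriveN dV).
  apply: (is_derive_eq (is_deriveM dp de)); rewrite /= !hornerE /=.
  rewrite -![_ *: _]/(_ * _) /=; field; lra.
- rewrite [X in is_derive _ _ _ X]/flat ltxx.
  have [C C0 CP] := flat_quadratic p.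
  exact: (is_derive_quadratic C0 CP).
Unshelve. all: by end_near. Qed.

Lemma flat1E s : 0 < s -> flat 1 s = expR (- s^-1).
Proof. by move=> s0; rewrite /flat s0 hornerC mul1r. Qed.

(* A smooth substitute for the positive part, up to the additive constant 1 at
   infinity. *)
Definition soft_pos s : R := s * flat 1 s.

Lemma soft_pos_le0 s : s <= 0 -> soft_pos s = 0.
Proof. by rewrite /soft_pos /flat => s0; rewrite ltNge s0 mulr0. Qed.

Lemma soft_pos_ge s : 0 < s -> s - 1 <= soft_pos s.
Proof.
move=> s0; rewrite /soft_pos flat1E//.
have := expR_ge1Dx (- s^-1); rewrite -(ler_pM2l s0); apply: le_trans.
by rewrite mulrBr mulr1 mulfV ?gt_eqF.
Qed.

(** Both bounds come from [1 + x <= exp x]: at [x = 1 / s] here, at [x = - 1 / s] in [soft_pos_ge].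
    The defect is thus 1 up to [1 / (s + 1)], which is small for a high lift. *)
Lemma soft_pos_le s : 0 < s -> soft_pos s <= s - 1 + (s + 1)^-1.
Proof.
move=> s0; rewrite /soft_pos flat1E// expRN.
have s1 : 0 < s^-1 by rewrite invr_gt0.
have -> : s - 1 + (s + 1)^-1 = s * (1 + s^-1)^-1 by field; lra.
rewrite ler_wpM2l ?(ltW s0)// lef_pV2 ?posrE ?expR_gt0 ?expR_ge1Dx//.
by rewrite addr_gt0.
Qed.

(** The slope [(1 + 1 / s) * exp (- 1 / s)] is at most 1, again by [1 + x <= exp x]. Composition
    with [soft_pos] therefore preserves the gradient bound 1. *)
Lemma is_derive_soft_pos s : exists2 k, 0 <= k <= 1 & is_derive s 1 soft_pos k.
Proof.
have := is_deriveM (is_derive_id s 1) (is_derive_flat 1 s).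
set k := (X in is_derive _ _ _ X) => dk; exists k; last by [].
rewrite /k derivC subr0 mul1r -![_ *: _]/(_ * _) /flat.
case: ifPn => [s0|_]; last by rewrite mulr0 mul0r addr0 lexx ler01.
rewrite !hornerE /=.
have s1 : 0 < s^-1 by rewrite invr_gt0.
have -> : s / s / s * expR (- s^-1) + expR (- s^-1) =
  (1 + s^-1) * expR (- s^-1) by field; lra.
apply/andP; split; first by rewrite mulr_ge0 ?expR_ge0// addr_ge0// ltW.
by rewrite expRN ler_pdivrMr ?expR_gt0// mul1r expR_ge1Dx.
Qed.

End Flat.

Section Elementary.
Variables (R : realType) (d : nat).
Notation E := 'rV[R]_d.

(* Closed under partial derivatives, hence made of smooth functions; the
   derivative [1 / f] of [ln f] is expressed as [exp (- ln f)]. *)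
Inductive elementary : (E -> R) -> Prop :=
| elementary_cst c : elementary (cst c)
| elementary_coord i : elementary (fun x => x 0 i)
| elementary_add f g : elementary f -> elementary g -> elementary (f + g)
| elementary_mul f g : elementary f -> elementary g -> elementary (f * g)
| elementary_exp f : elementary f -> elementary (@expR R \o f)
| elementary_ln f : elementary f -> (forall x, 0 < f x) -> elementary (@ln R \o f)
| elementary_flat p f : elementary f -> elementary (flat p \o f).

Lemma is_derive_coord (x v : E) i : is_derive x v (fun y : E => y 0 i) (v 0 i).
Proof.
have quot (h : R) : h != 0 ->
    h^-1 *: (((fun y : E => y 0 i) \o shift x) (h *: v) - x 0 i) = v 0 i.
  by move=> h0; rewrite /= !mxE addrK -[_ *: _]/(_ * _) mulKf.
have lim_quot : (fun h : R => h^-1 *: (((fun y : E => y 0 i) \o shift x) (h *: v)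
    - x 0 i)) @ 0^' --> v 0 i.
  apply: cvg_near_cst; near=> h; apply: quot; near: h; exact: nbhs_dnbhs_neq.
by split; [apply/cvg_ex; exists (v 0 i)|exact/cvg_lim].
Unshelve. all: by end_near. Qed.

Lemma elementary_derive f : elementary f -> continuous f /\
  forall i, exists2 df, elementary df &
    forall x, is_derive x (delta_mx 0 i : E) f (df x).
Proof.
elim=> {f} [c|j|f g ef [cf df] eg [cg dg]|f g ef [cf df] eg [cg dg]|
  f ef [cf df]|f ef [cf df] f0|p f ef [cf df]].
- split; first exact: cst_continuous.
  move=> i; exists (cst 0) => [|x]; first exact: elementary_cst.
  exact: is_derive_cst.
- split; first exact: (@coord_continuous R 1 d 0 j).
  move=> i; exists (cst ((delta_mx 0 i : E) 0 j)); first exact: elementary_cst.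
  by move=> x; exact: is_derive_coord.
- split; first by move=> x; apply: continuousD; [exact: cf|exact: cg].
  move=> i; have [df' e1 d1] := df i; have [dg' e2 d2] := dg i.
  by exists (df' + dg') => [|x]; [exact: elementary_add|exact: is_deriveD].
- split; first by move=> x; apply: continuousM; [exact: cf|exact: cg].
  move=> i; have [df' e1 d1] := df i; have [dg' e2 d2] := dg i.
  exists (f * dg' + g * df'); last by move=> x; exact: is_deriveM.
  by apply: elementary_add; exact: elementary_mul.
- split; first by move=> x; apply: continuous_comp; [exact: cf|exact: continuous_expR].
  move=> i; have [df' e1 d1] := df i; exists ((@expR R \o f) * df').
    by apply: elementary_mul => //; exact: elementary_exp.
  by move=> x; apply: is_derive_comp1 => //; exact: is_derive_expR.
- split; first by move=> x; apply: continuous_comp; [exact: cf|exact: continuous_ln].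
  move=> i; have [df' e1 d1] := df i.
  exists ((@expR R \o (cst (-1) * (@ln R \o f))) * df').
    apply: elementary_mul => //; apply/elementary_exp/elementary_mul.
      exact: elementary_cst.
    exact: elementary_ln.
  move=> x; apply: is_derive_comp1 => //=.
  rewrite -[(cst (-1) * (@ln R \o f)) x]/(-1 * ln (f x)) mulN1r expRN.
  by rewrite lnK ?posrE//; exact: is_derive1_ln.
- split.
    move=> x; apply: continuous_comp; first exact: cf.
    apply/differentiable_continuous/derivable1_diffP.
    exact: (@ex_derive _ _ _ _ _ _ _ (is_derive_flat p (f x))).
  move=> i; have [df' e1 d1] := df i.
  exists ((flat ((p - p^`()) * 'X^2) \o f) * df').
    by apply: elementary_mul => //; exact: elementary_flat.
  by move=> x; apply: is_derive_comp1 => //; exact: is_derive_flat.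
Qed.

Lemma elementary_smooth f : elementary f -> smooth f.
Proof.
move=> ef s; suff es : elementary (partials s f).
  have [cf df] := elementary_derive es; split => // i x.
  by have [g _ /(_ x)[]] := df i.
elim: s => //= i s /elementary_derive[_ /(_ i)[g eg dg]].
suff -> : partial i (partials s f) = g by [].
by apply/funext => x; apply: derive_val.
Qed.

Lemma elementary_sum n (f : 'I_n -> E -> R) :
  (forall i, elementary (f i)) -> elementary (\sum_(i < n) f i).
Proof.
move=> ef; elim/big_ind: _ => //; first exact: elementary_cst.
exact: elementary_add.
Qed.

End Elementary.

(** * The mass of a filling is at least the cost of an optimal matching *)

Section TestFunctionConstruction.
Variables (R : realType) (d : nat).
Notation E := 'rV[R]_d.

Definition grad_le1 (f : E -> R) (z : E) :=
  exists2 G : E, enorm G <= 1 & forall v, is_derive z v f (dotp G v).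

(** A smooth 1-Lipschitz substitute for the Euclidean distance to [q], which it exceeds by at most
    [e]. *)
Definition cone (e : R) (q z : E) : R := Num.sqrt (e ^+ 2 + dotp (z - q) (z - q)).

Lemma cone_gt0 e q z : 0 < e -> 0 < cone e q z.
Proof. by move=> e0; rewrite sqrtr_gt0 ltr_wpDr ?dotp_ge0 ?exprn_gt0. Qed.

Lemma enorm_le_cone e q z : enorm (z - q) <= cone e q z.
Proof. by rewrite ler_sqrt ?lerDr ?sqr_ge0// addr_ge0 ?sqr_ge0 ?dotp_ge0. Qed.

Lemma cone_le e q z : 0 <= e -> cone e q z <= e + enorm (z - q).
Proof.
move=> e0; rewrite -(ler_pXn2r (n := 2)) ?nnegrE ?sqrtr_ge0 ?addr_ge0 ?enorm_ge0//.
rewrite sqr_sqrtr ?addr_ge0 ?sqr_ge0 ?dotp_ge0// sqrrD sqr_enorm.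
by rewrite lerD2r lerDl mulrn_wge0// mulr_ge0 ?enorm_ge0.
Qed.

Lemma elementary_cone e q : 0 < e -> elementary (cone e q).
Proof.
move=> e0.
pose s : E -> R := cst (e ^+ 2) + \sum_(i < d)
  ((fun z : E => z 0 i) + cst (- q 0 i)) * ((fun z : E => z 0 i) + cst (- q 0 i)).
have sE z : s z = e ^+ 2 + dotp (z - q) (z - q).
  rewrite /s fctE; congr (_ + _); rewrite fct_sumE; apply: eq_bigr => i _.
  by rewrite !mxE.
have s0 z : 0 < s z by rewrite sE ltr_wpDr ?dotp_ge0 ?exprn_gt0.
(* Square roots are not generators of [elementary]; on positive reals they are [exp (ln / 2)]. *)
have -> : cone e q = @expR R \o (cst 2^-1 * (@ln R \o s)).
  apply/funext => z; rewrite /cone -sE -powR12_sqrt ?(ltW (s0 z))//.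
  by rewrite /powR gt_eqF.
apply/elementary_exp/elementary_mul; first exact: elementary_cst.
apply: elementary_ln => //; apply: elementary_add; first exact: elementary_cst.
apply: elementary_sum => i; apply: elementary_mul; apply: elementary_add;
  by [exact: elementary_coord|exact: elementary_cst].
Qed.

Lemma is_derive_dotp_sub (q z v : E) :
  is_derive z v (fun y => dotp (y - q) (y - q)) (2 * dotp (z - q) v).
Proof.
pose h i : E -> R := (fun y : E => y 0 i) + cst (- q 0 i).
have -> : (fun y => dotp (y - q) (y - q)) = \sum_(i < d) h i * h i.
  by apply/funext => y; rewrite fct_sumE; apply: eq_bigr => i _; rewrite !mxE.
have dh i : is_derive z v (h i) (v 0 i + 0).
  by apply: is_deriveD; exact: is_derive_coord.
apply: (is_derive_eq (is_derive_sum (fun i => is_deriveM (dh i) (dh i)))).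
rewrite /dotp mulr_sumr; apply: eq_bigr => i _.
by rewrite -![_ *: _]/(_ * _) addr0 !mxE /h !fctE /=; ring.
Qed.

Lemma grad_le1_cone e q z : 0 < e -> grad_le1 (fun y => - cone e q y) z.
Proof.
move=> e0; have c0 := cone_gt0 q z e0.
exists (- ((cone e q z)^-1 *: (z - q))) => [|v].
  rewrite enormN enormZ ger0_norm ?invr_ge0 ?(ltW c0)//.
  by rewrite ler_pdivrMl// mulr1 enorm_le_cone.
rewrite dotpNl.
rewrite (_ : (fun y => - cone e q y) =
  - (@Num.sqrt R \o (cst (e ^+ 2) + (fun y => dotp (y - q) (y - q)))))//.
apply: is_deriveN.
have s0 : 0 < e ^+ 2 + dotp (z - q) (z - q).
  by rewrite ltr_wpDr ?dotp_ge0 ?exprn_gt0.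
have ds := is_deriveD (is_derive_cst (e ^+ 2) z v) (is_derive_dotp_sub q z v).
have s0' : 0 < (cst (e ^+ 2) + (fun y => dotp (y - q) (y - q))) z by [].
apply: (is_derive_eq (is_derive_comp1 (is_derive1_sqrt s0') ds)).
rewrite add0r dotpZl -/(cone e q z).
by field; rewrite gt_eqF.
Qed.

(** Log-sum-exp at temperature [e], which exceeds the maximum of the [f j] by at most [e * ln n]. *)
Definition softmax n (e : R) (f : 'I_n -> E -> R) (z : E) : R :=
  e * ln (\sum_(j < n) expR (e^-1 * f j z)).

Lemma softmax_sum_gt0 n e (f : 'I_n.+1 -> E -> R) z :
  0 < \sum_(j < n.+1) expR (e^-1 * f j z).
Proof.
by rewrite big_ord_recl ltr_wpDr ?expR_gt0// sumr_ge0// => i _; exact: expR_ge0.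
Qed.

Lemma elementary_softmax n e (f : 'I_n.+1 -> E -> R) :
  (forall j, elementary (f j)) -> elementary (softmax e f).
Proof.
move=> ef.
have -> : softmax e f = cst e *
    (@ln R \o \sum_(j < n.+1) (@expR R \o (cst e^-1 * f j))).
  by apply/funext => z; rewrite /softmax fctE /= fct_sumE.
apply: elementary_mul; first exact: elementary_cst.
apply: elementary_ln => [|z]; last first.
  by rewrite fct_sumE; exact: softmax_sum_gt0.
apply: elementary_sum => j; apply: elementary_exp.
by apply: elementary_mul => //; exact: elementary_cst.
Qed.

(** The gradient of log-sum-exp is the convex combination of the gradients with weights proportional
    to [expR (e^-1 * f j z)]. *)
Lemma grad_le1_softmax n e (f : 'I_n.+1 -> E -> R) z : 0 < e ->
  (forall j, grad_le1 (f j) z) -> grad_le1 (softmax e f) z.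
Proof.
move=> e0 gf.
have {gf}[G GP] : {G : 'I_n.+1 -> E & forall j, enorm (G j) <= 1 /\
    forall v, is_derive z v (f j) (dotp (G j) v)}.
  apply: (@choice _ _ (fun j Gj => enorm Gj <= 1 /\
    forall v, is_derive z v (f j) (dotp Gj v))) => j.
  by have [Gj] := gf j; exists Gj.
pose w j := expR (e^-1 * f j z); pose s := \sum_(j < n.+1) w j.
have s0 : 0 < s by exact: softmax_sum_gt0.
exists (s^-1 *: \sum_j w j *: G j) => [|v].
  rewrite enormZ ger0_norm ?invr_ge0 ?(ltW s0)// ler_pdivrMl// mulr1.
  apply: le_trans (enorm_sum _ _ _) (ler_sum _ _) => j _.
  rewrite enormZ ger0_norm ?expR_ge0// ler_piMr ?expR_ge0//.
  exact: (GP j).1.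
have ds : is_derive z v (\sum_(j < n.+1) (@expR R \o (cst e^-1 * f j)))
    (\sum_j w j * (e^-1 * dotp (G j) v)).
  apply: is_derive_sum => j.
  have de := is_derive_expR ((cst e^-1 * f j) z).
  apply: (is_derive_comp1 de).
  apply: (is_derive_eq (is_deriveM (is_derive_cst e^-1 z v) ((GP j).2 v))).
  by rewrite scaler0 addr0.
have s0' : 0 < (\sum_(j < n.+1) (@expR R \o (cst e^-1 * f j))) z.
  by rewrite fct_sumE.
have dl := is_derive_comp1 (is_derive1_ln s0') ds.
have -> : softmax e f = cst e *
    (@ln R \o \sum_(j < n.+1) (@expR R \o (cst e^-1 * f j))).
  by apply/funext => y; rewrite /softmax fctE /= fct_sumE.
apply: (is_derive_eq (is_deriveM (is_derive_cst e z v) dl)).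
rewrite scaler0 addr0 -[_ *: _]/(_ * _) fct_sumE -/s dotpZl /=.
have -> : \sum_j w j * (e^-1 * dotp (G j) v) = e^-1 * dotp (\sum_j w j *: G j) v.
  rewrite dotpC /dotp mulr_sumr.
  under [RHS]eq_bigr do rewrite summxE mulr_sumr mulr_sumr.
  rewrite exchange_big; apply: eq_bigr => j _.
  rewrite /dotp !mulr_sumr; apply: eq_bigr => i _.
  by rewrite mxE; ring.
by rewrite mulrCA mulVKf ?gt_eqF.
Qed.

Lemma softmax_ge n e (f : 'I_n.+1 -> E -> R) z j : 0 < e ->
  f j z <= softmax e f z.
Proof.
move=> e0; rewrite /softmax -ler_pdivrMl// -[leLHS]expRK ler_ln ?posrE ?expR_gt0//.
  by rewrite (bigD1 j)//= lerDl sumr_ge0// => i _; exact: expR_ge0.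
exact: softmax_sum_gt0.
Qed.

Lemma softmax_le n e (f : 'I_n.+1 -> E -> R) z K : 0 < e ->
  (forall j, f j z <= K) -> softmax e f z <= K + e * ln n.+1%:R.
Proof.
move=> e0 fK; rewrite /softmax -ler_pdivlMl// mulrDr mulKf ?gt_eqF//.
rewrite -[X in X + _]expRK -lnM ?posrE ?expR_gt0 ?ltr0n//.
rewrite ler_ln ?posrE ?mulr_gt0 ?expR_gt0 ?ltr0n ?softmax_sum_gt0//.
apply: (@le_trans _ _ (\sum_(j < n.+1) expR (e^-1 * K))).
  by apply: ler_sum => j _; rewrite ler_expR ler_wpM2l ?invr_ge0 ?(ltW e0).
by rewrite sumr_const card_ord mulr_natr.
Qed.

(** Where [|z| > B + c] the argument of [soft_pos] is negative, so the support lies in a ball,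
    however large the lift [c] is. *)
Lemma test_function_soft_pos (f : E -> R) (c B : R) : elementary f ->
  (forall z, f z <= B - `|z|) ->
  test_function (fun z => soft_pos (f z + c)).
Proof.
move=> ef fB; split.
  have -> : (fun z => soft_pos (f z + c)) = (f + cst c) * (flat 1 \o (f + cst c)).
    by apply/funext.
  apply: elementary_smooth.
  have efc : elementary (f + cst c).
    by apply: elementary_add => //; exact: elementary_cst.
  by apply: elementary_mul => //; exact: elementary_flat.
have cK : closed [set z : E | `|z| <= B + c].
  have := @closed_le R (B + c); rewrite /mkset => /closed_comp; apply => z _.
  exact: norm_continuous.
have K : compact [set z : E | `|z| <= B + c].
  apply: bounded_closed_compact => //.
  by exists (B + c); split; [exact: num_real|move=> M BM z /= /le_lt_trans/(_ BM)/ltW].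
apply: (subclosed_compact _ K); first exact: closed_closure.
rewrite ((closure_id _).1 cK); apply: closureS => z /= fz.
rewrite leNgt; apply: contra fz => Bz; apply/eqP/soft_pos_le0.
have := fB z; lra.
Qed.

Lemma soft_test (f : E -> R) (B : R) : elementary f ->
  (forall z, f z <= B - `|z|) -> (forall z, grad_le1 f z) ->
  forall c, exists F : testfun R d, (forall z, F z = soft_pos (f z + c)) /\
    forall z, enorm (form1_at (ext_d F) z) <= 1.
Proof.
move=> ef fB gf c.
exists (TestFun (asboolT (test_function_soft_pos c ef fB))); split => // z.
have [G G1 dG] := gf z; have [k /andP[k0 k1] dk] := is_derive_soft_pos (f z + c).
have -> : form1_at (ext_d (TestFun (asboolT (test_function_soft_pos c ef fB)))) z
    = k *: G.
  apply/rowP => i; rewrite !mxE ffunE /=.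
  have dfc := is_deriveD (dG (delta_mx 0 i)) (is_derive_cst c z (delta_mx 0 i)).
  have dk' : is_derive ((f + cst c) z) 1 (@soft_pos R) k by [].
  have D := is_derive_comp1 dk' dfc.
  transitivity ('D_(delta_mx 0 i) (@soft_pos R \o (f + cst c)) z); first by [].
  rewrite derive_val addr0; congr (k * _).
  rewrite /dotp (bigD1 i)//= big1 ?addr0 => [|j ji]; rewrite !mxE ?eqxx ?mulr1//.
  by rewrite (negPf ji) mulr0.
by rewrite enormZ ger0_norm// mulr_ile1// enorm_ge0.
Qed.

End TestFunctionConstruction.

(** * Lower bound on the mass and neutrality of the charge *)

Section LowerBound.
Variables (R : realType) (d : nat).
Notation E := 'rV[R]_d.

Lemma boundary_le_mass (T : current1 R d) (F : testfun R d) :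
  (forall z, enorm (form1_at (ext_d F) z) <= 1) ->
  ((boundary T F)%:E <= mass1 T)%E.
Proof. by move=> F1; apply: ereal_sup_ubound; exists (ext_d F). Qed.

Lemma mass1_ge0 (T : current1 R d) : (0 <= mass1 T)%E.
Proof.
apply: ereal_sup_ubound; exists 0; last by rewrite linear0.
move=> z /=; rewrite (_ : form1_at 0 z = 0) ?enorm0 ?ler01//.
by apply/rowP => i; rewrite !mxE ffunE.
Qed.

Lemma cone_upper (e : R) (q z : E) (g : R) :
  g - cone e q z <= g + `|q| - `|z|.
Proof.
have := enorm_le_cone e q z; have := mx_norm_le_enorm (z - q).
have := ler_normD (z - q) q; rewrite subrK; lra.
Qed.

(* Kantorovich duality: the potential [max_j (g j - |z - q j|)] is 1-Lipschitz,
   takes at least the value [g i] at [q i], and [g i - |p i - q i|] at [p i]. *)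
Lemma min_matching_le_mass n (p q : 'I_n -> E) (T : current1 R d) :
  (forall f, boundary T f = \sum_i (f (q i) - f (p i))) ->
  (forall s : 'S_n, \sum_i enorm (p i - q i) <= \sum_i enorm (p i - q (s i))) ->
  ((\sum_i enorm (p i - q i))%:E <= mass1 T)%E.
Proof.
(* The maximum defining the potential needs at least one sink; the empty matching costs 0. *)
case: n p q => [|n] p q bT pq_min; first by rewrite big_ord0 mass1_ge0.
have [g gP] := @exists_dual_potential R n.+1 (fun i j => enorm (p i - q j)) pq_min.
apply/lee_addgt0Pr => D D0.
set l := ln (n.+1%:R : R).
have l0 : 0 <= l by rewrite ln_ge0// ler1n.
pose N : R := n.+1%:R; have N0 : 0 < N by rewrite ltr0n.
(* For each of the [N] pairs, smoothing loses [e] at the sink and [e * l] at the source, and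
   [soft_pos] loses [K^-1]. Both [e * (1 + l)] and [K^-1] equal [D / (2 * N)], so the total loss is
   [D]. *)
pose e := D / (2 * N * (1 + l)); pose K := 2 * N / D.
have l1 : 0 < 1 + l by rewrite ltr_pwDl.
have e0 : 0 < e by rewrite divr_gt0// !mulr_gt0.
have K0 : 0 < K by rewrite divr_gt0// mulr_gt0.
pose f j z := g j - cone e (q j) z.
(* This lift makes the potential at least [K] at every source and positive at every sink; a sum of
   absolute values stands for a maximum. *)
pose c := \sum_i `|e + enorm (p i - q i) - g i| + K.
have cP i : e + enorm (p i - q i) - g i + K <= c.
  rewrite lerD2r (bigD1 i)//= (le_trans (ler_norm _))// lerDl.
  by apply: sumr_ge0.
have ef j : elementary (f j).
  rewrite (_ : f j = cst (g j) + cst (-1) * cone e (q j)).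
    apply: elementary_add; first exact: elementary_cst.
    by apply: elementary_mul; [exact: elementary_cst|exact: elementary_cone].
  by apply/funext => z; rewrite /f !fctE mulN1r.
have gf j z : grad_le1 (f j) z.
  have [G G1 dG] := grad_le1_cone (q j) z e0; exists G => // v.
  apply: (is_derive_eq (is_deriveD (is_derive_cst (g j) z v) (dG v))).
  by rewrite add0r.
pose B := \sum_j `|g j + `|q j| | + e * l.
have fB z : softmax e f z <= B - `|z|.
  rewrite /B addrAC; apply: softmax_le => // j.
  apply: le_trans (cone_upper _ _ _ _) _; rewrite lerD2r.
  rewrite (bigD1 j)//= (le_trans (ler_norm _))// lerDl.
  by apply: sumr_ge0.
have [F [FE F1]] := soft_test (elementary_softmax e ef) fB
  (fun z => grad_le1_softmax e0 (fun j => gf j z)) c.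
apply: le_trans (leeD2r _ (boundary_le_mass T F1)).
rewrite bT -EFinD lee_fin -lerBlDr.
have -> : \sum_i enorm (p i - q i) - D =
    \sum_i (enorm (p i - q i) - e * (1 + l) - K^-1).
  rewrite !sumrB !sumr_const card_ord -(mulr_natr (e * (1 + l))) -(mulr_natr K^-1).
  rewrite -/N -addrA -opprD.
  by congr (_ - _); rewrite /e /K; field; rewrite !gt_eqF.
apply: ler_sum => i _; rewrite !FE.
set sq := softmax e f (q i) + c; set sp := softmax e f (p i) + c.
have sqP : g i - e + c <= sq.
  rewrite lerD2r; apply: le_trans (softmax_ge f (q i) i e0).
  by rewrite /f lerD2l lerN2 (le_trans (cone_le _ _ (ltW e0)))// subrr enorm0 addr0.
have spP : sp <= g i - enorm (p i - q i) + e * l + c.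
  rewrite lerD2r; apply: softmax_le => // j.
  by apply: le_trans (gP i j); rewrite lerD2l lerN2 enorm_le_cone.
have spK : K <= sp.
  have := softmax_ge f (p i) i e0; have := cone_le (q i) (p i) (ltW e0).
  have := cP i; rewrite /sp /f; lra.
have sq0 : 0 < sq.
  have := cP i; have := enorm_ge0 (p i - q i); lra.
have sp0 : 0 < sp by exact: lt_le_trans spK.
have spV : (sp + 1)^-1 <= K^-1.
  have sp1 : 0 < sp + 1 by rewrite addr_gt0.
  by rewrite lef_pV2 ?posrE//; move: spK; clear; lra.
(* The defects 1 of [soft_pos] at [q i] and at [p i] cancel in the difference. *)
have := soft_pos_ge sq0; have := soft_pos_le sp0.
clearbody sq sp; clearbody c; move: sqP spP spV; clear.
move: (soft_pos sq) (soft_pos sp) (sp + 1)^-1 K^-1 => t1 t2 t3 t4.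
lra.
Qed.

(* A finite-mass current has bounded action on the differentials of the
   truncated cones, whose height [c] is arbitrary. *)
Lemma boundary_neutral (Nm Np : nat) (a : 'I_Nm -> nat) (x : 'I_Nm -> E)
    (b : 'I_Np -> nat) (y : 'I_Np -> E) (S : current1 R d) :
  (mass1 S < +oo)%E ->
  (forall f : testfun R d, boundary S f =
     - (\sum_(i < Nm) (a i)%:R * f (x i)) + \sum_(j < Np) (b j)%:R * f (y j)) ->
  (\sum_i a i = \sum_j b j)%N.
Proof.
move=> mS bS.
have ef : elementary (fun z : E => - cone 1 0 z).
  rewrite (_ : (fun _ => _) = cst (-1) * cone 1 0).
    by apply: elementary_mul; [exact: elementary_cst|exact: elementary_cone].
  by apply/funext => z; rewrite fctE mulN1r.
have fB (z : E) : - cone 1 0 z <= 0 - `|z|.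
  by have := cone_upper 1 0 z 0; rewrite normr0 addr0 add0r.
have Fc := soft_test ef fB (fun z => grad_le1_cone 0 z ltr01).
have [M SM] : exists M, mass1 S = M%:E.
  by exists (fine (mass1 S)); rewrite fineK// ge0_fin_numE// mass1_ge0.
have SF (F : testfun R d) : (forall z, enorm (form1_at (ext_d F) z) <= 1) ->
    `|boundary S F| <= M.
  move=> F1; rewrite ler_norml lerNl -linearN -!lee_fin -SM.
  rewrite !boundary_le_mass// => z.
  rewrite (_ : form1_at _ _ = - form1_at (ext_d F) z) ?enormN//.
  by apply/rowP => i; rewrite linearN !mxE ffunE.
pose A : R := \sum_(i < Nm) (a i)%:R; pose B : R := \sum_(j < Np) (b j)%:R.
(* At each point the truncated cone falls short of its height [c] by at most [cone + 1]. With these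
   losses collected in [C], the action of [S] is at least [|B - A| * c - C] in absolute value, and
   it is at most [M] for arbitrarily large [c]. *)
pose C : R := \sum_(i < Nm) (a i)%:R * (cone 1 0 (x i) + 1) +
  \sum_(j < Np) (b j)%:R * (cone 1 0 (y j) + 1).
pose c0 : R := \sum_(i < Nm) cone 1 0 (x i) + \sum_(j < Np) cone 1 0 (y j).
have cone_ge0 (z : E) : 0 <= cone 1 0 z by exact: sqrtr_ge0.
have near_c c (z : E) : c0 < c -> cone 1 0 z <= c0 ->
    c - (cone 1 0 z + 1) <= soft_pos (- cone 1 0 z + c) <= c.
  move=> c0c zc; have s0 : 0 < - cone 1 0 z + c by lra.
  have := soft_pos_ge s0; have := soft_pos_le s0.
  have : (- cone 1 0 z + c + 1)^-1 <= 1.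
    by rewrite invf_le1; lra.
  by have := cone_ge0 z; lra.
have xc i : cone 1 0 (x i) <= c0.
  rewrite /c0 (bigD1 i)//= -addrA lerDl addr_ge0// sumr_ge0//.
have yc j : cone 1 0 (y j) <= c0.
  rewrite /c0 [X in _ + X](bigD1 j)//= addrCA lerDl addr_ge0// sumr_ge0//.
have c0_ge0 : 0 <= c0 by rewrite addr_ge0// sumr_ge0.
have C0 : 0 <= C.
  by rewrite addr_ge0// sumr_ge0// => i _; rewrite mulr_ge0// addr_ge0.
have key c : c0 < c -> `|B - A| * c <= M + C.
  move=> c0c; have [F [FE F1]] := Fc c.
  have := SF F F1; rewrite bS.
  set SA := \sum_(i < Nm) _; set SB := \sum_(j < Np) _ => H.
  have : A * c - \sum_(i < Nm) (a i)%:R * (cone 1 0 (x i) + 1) <= SA <= A * c.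
    rewrite /A mulr_suml -sumrB; apply/andP; split; apply: ler_sum => i _;
      rewrite -?mulrBr ler_wpM2l// FE; by have /andP[] := near_c c (x i) c0c (xc i).
  have : B * c - \sum_(j < Np) (b j)%:R * (cone 1 0 (y j) + 1) <= SB <= B * c.
    rewrite /B mulr_suml -sumrB; apply/andP; split; apply: ler_sum => i _;
      rewrite -?mulrBr ler_wpM2l// FE; by have /andP[] := near_c c (y i) c0c (yc i).
  have CA : 0 <= \sum_(i < Nm) (a i)%:R * (cone 1 0 (x i) + 1).
    by rewrite sumr_ge0// => i _; rewrite mulr_ge0// addr_ge0.
  have CB : 0 <= \sum_(j < Np) (b j)%:R * (cone 1 0 (y j) + 1).
    by rewrite sumr_ge0// => i _; rewrite mulr_ge0// addr_ge0.
  have c_ge0 : 0 <= c by lra.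
  move=> HB HA; rewrite -[X in _ * X]ger0_norm// -normrM mulrBl.
  move: H; rewrite ler_norml => H; rewrite ler_norml /C; lra.
have : B - A = 0.
  clearbody C c0; apply/eqP; apply: contraT => BA0.
  have BA : 0 < `|B - A| by rewrite normr_gt0.
  have MC : 0 <= M + C.
    apply: le_trans (key (c0 + 1) _); last by rewrite ltrDl.
    by rewrite mulr_ge0// addr_ge0.
  have := key (c0 + (M + C) / `|B - A| + 1).
  have q0 : 0 <= (M + C) / `|B - A| by rewrite divr_ge0.
  rewrite -addrA ltrDl ltr_wpDl// => /(_ isT).
  rewrite !mulrDr mulr1 mulrCA divff ?gt_eqF// mulr1.
  have : 0 <= `|B - A| * c0 by rewrite mulr_ge0.
  move: BA; clear; lra.
rewrite /A /B -!natr_sum => /eqP; rewrite subr_eq0 eqr_nat eq_sym.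
by move/eqP.
Qed.

End LowerBound.

(** * Measurability for the Hausdorff measure *)

Section HausdorffMetricOuter.
Variables (R : realType) (d : nat).
Notation E := 'rV[R]_d.
Local Open Scope ereal_scope.
Implicit Types A B X : set E.

Lemma enorm_le_diam A x y : A x -> A y -> (enorm (x - y))%:E <= diam A.
Proof. by move=> Ax Ay; apply: ereal_sup_ubound; right; exists x => //; exists y. Qed.

Lemma diam_le A (r : R) : (0 <= r)%R ->
  (forall x y, A x -> A y -> (enorm (x - y) <= r)%R) -> diam A <= r%:E.
Proof.
move=> r0 Ar; apply: ge_ereal_sup => _ [->|[x Ax [y Ay <-]]]; rewrite lee_fin//.
exact: Ar.
Qed.

Lemma hausdorff1_pre_antitone (r s : R) A : (r <= s)%R ->
  hausdorff1_pre s A <= hausdorff1_pre r A.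
Proof.
move=> rs; apply: ereal_inf_le_tmp => _ [F [Fr AF] <-]; exists F => //; split=> // k.
by apply: le_trans (Fr k) _; rewrite lee_fin.
Qed.

Lemma hausdorff1_pre_le (r : R) A : (0 < r)%R -> hausdorff1_pre r A <= hausdorff1 A.
Proof. by move=> r0; apply: ereal_sup_ubound; exists r. Qed.

(** A set of diameter at most [r] cannot meet both [A] and [B], so every admissible cover of the
    union splits into a cover of each. *)
Lemma hausdorff1_pre_separated (r : R) A B :
  (forall x y, A x -> B y -> (r < enorm (x - y))%R) ->
  hausdorff1_pre r A + hausdorff1_pre r B <= hausdorff1_pre r (A `|` B).
Proof.
move=> AB; apply: le_ereal_inf_tmp => _ [F [Fr ABF] <-].
pose G C k := if `[< F k `&` C !=set0 >] then F k else set0.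
have dG C k : diam (G C k) <= diam (F k).
  by rewrite /G; case: ifP => // _; rewrite diam0 diam_ge0.
have GP C : C `<=` A `|` B -> hausdorff1_pre r C <= \sum_(k <oo) diam (G C k).
  move=> CAB; apply: ereal_inf_lbound; exists (G C) => //; split=> [k|x Cx].
    exact: le_trans (dG C k) (Fr k).
  have [k _ Fkx] := ABF _ (CAB _ Cx); exists k => //.
  by rewrite /G ifT//; apply/asboolP; exists x.
have GA := GP A (@subsetUl _ _ _); have GB := GP B (@subsetUr _ _ _).
apply: le_trans (leeD GA GB) _.
rewrite -nneseriesD; [|by move=> *; exact: diam_ge0..].
apply: lee_nneseries => [k _ _|k _]; first by rewrite adde_ge0// diam_ge0.
rewrite /G; case: asboolP => [[x [Fx Ax]]|_]; last first.
  by rewrite diam0 add0e; case: ifP => // _; rewrite diam0 diam_ge0.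
rewrite ifF ?diam0 ?adde0//; apply/asboolP => -[y [Fy By]].
have := le_trans (enorm_le_diam Fx Fy) (Fr k).
by rewrite lee_fin leNgt AB.
Qed.

Lemma hausdorff1_separated (e : R) A B : (0 < e)%R ->
  (forall x y, A x -> B y -> (e <= enorm (x - y))%R) ->
  hausdorff1 A + hausdorff1 B <= hausdorff1 (A `|` B).
Proof.
move=> e0 AB; set H := hausdorff1 (A `|` B).
have [->|Hoo] := eqVneq H +oo; first exact: leey.
have Hfin : H \is a fin_num.
  by rewrite ge0_fin_numE ?hausdorff1_ge0// lt_neqAle Hoo leey.
have preAB (r s : R) : (0 < r)%R -> (0 < s)%R ->
    hausdorff1_pre r A + hausdorff1_pre s B <= H.
  (* The two suprema range over independent scales; both are compared at one common scale, taken
     strictly below the separation [e]. *)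
  move=> r0 s0; pose m : R := Num.min (Num.min r s) (e / 2)%R.
  have m0 : (0 < m)%R by rewrite !lt_min r0 s0 divr_gt0.
  apply: le_trans (hausdorff1_pre_le _ m0).
  apply: le_trans (leeD _ _) (hausdorff1_pre_separated _).
  - by apply: hausdorff1_pre_antitone; rewrite /m !ge_min lexx.
  - by apply: hausdorff1_pre_antitone; rewrite /m !ge_min lexx orbT.
  - move=> x y Ax By; apply: lt_le_trans (AB _ _ Ax By).
    by rewrite /m gt_min ltr_pdivrMr// ltr_pMr// ltr1n orbT.
have preB s : (0 < s)%R -> hausdorff1_pre s B \is a fin_num.
  move=> s0; rewrite ge0_fin_numE ?hausdorff1_pre_ge0//.
  apply: le_lt_trans (le_trans _ (preAB 1%R s ltr01 s0)) _.
    by rewrite leeDr ?hausdorff1_pre_ge0.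
  by rewrite lt_neqAle Hoo leey.
have Bfin : hausdorff1 B \is a fin_num.
  rewrite ge0_fin_numE ?hausdorff1_ge0//.
  apply: (@le_lt_trans _ _ H); last by rewrite lt_neqAle Hoo leey.
  apply: ge_ereal_sup => _ [s s0 <-].
  apply: le_trans (preAB 1%R s ltr01 s0).
  by rewrite leeDr ?hausdorff1_pre_ge0.
rewrite -leeBrDr//; apply: ge_ereal_sup => _ [r r0 <-].
rewrite leeBrDr// addeC -leeBrDr; last first.
  rewrite ge0_fin_numE ?hausdorff1_pre_ge0//.
  apply: le_lt_trans (le_trans _ (preAB r 1%R r0 ltr01)) _.
    by rewrite leeDl ?hausdorff1_pre_ge0.
  by rewrite lt_neqAle Hoo leey.
apply: ge_ereal_sup => _ [s s0 <-].
rewrite leeBrDr; last first.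
  rewrite ge0_fin_numE ?hausdorff1_pre_ge0//.
  apply: le_lt_trans (le_trans _ (preAB r 1%R r0 ltr01)) _.
    by rewrite leeDl ?hausdorff1_pre_ge0.
  by rewrite lt_neqAle Hoo leey.
by rewrite addeC; exact: preAB.
Qed.

Definition lip1 (f : E -> R) := forall x y, (`|f x - f y| <= enorm (x - y))%R.

Lemma hausdorff1_gap (f : E -> R) (a b : R) X : lip1 f -> (a < b)%R ->
  hausdorff1 (X `&` [set x | (f x <= a)%R]) +
  hausdorff1 (X `&` [set x | (b < f x)%R]) <= hausdorff1 X.
Proof.
move=> f1 ab; apply: le_trans (hausdorff1_separated (e := (b - a)%R) _ _) _.
- by rewrite subr_gt0.
- move=> x y [_ /= fx] [_ /= fy]; apply: le_trans (f1 x y).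
  by rewrite distrC (le_trans _ (ler_norm _))//; lra.
- by apply: le_hausdorff1 => x [] [].
Qed.

Section Layers.
Variables (f : E -> R) (X : set E).
Hypotheses (f1 : lip1 f) (Xfin : hausdorff1 X < +oo).

(** Caratheodory's criterion for metric outer measures: layers of the same parity are separated from
    each other, so the sums over even and over odd indices are each at most [hausdorff1 X], and the
    full series converges. *)
Let layer k := X `&` [set x | (k.+2%:R^-1 < f x <= k.+1%:R^-1)%R].

Let layers_half b n : \sum_(0 <= k < n) hausdorff1 (layer (k.*2 + b)) <=
  hausdorff1 (X `&` [set x | ((n.*2 + b)%:R^-1 < f x)%R]).
Proof.
elim: n => [|n IH]; first by rewrite big_geq ?hausdorff1_ge0.
rewrite big_nat_recr//=; set m := (n.*2 + b)%N in IH *.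
have -> : (n.+1.*2 + b = m.+2)%N by rewrite doubleS.
(* For [n = 0] the index [m] may be 0, whose inverse is the default value 0 and leaves no gap above
   the layer; the earlier sum is then empty. *)
have [n0|n0] := posnP n.
  rewrite n0 big_geq// add0e; apply: le_hausdorff1 => x [Xx /andP[fx _]].
  by split.
have m0 : (0 < m)%N by rewrite addn_gt0 double_gt0 n0.
have mlt j : (0 < j)%N -> (j.+1%:R^-1 < j%:R^-1 :> R)%R.
  by move=> j0; rewrite ltf_pV2 ?posrE ?ltr0n// ltr_nat.
apply: le_trans (leeD IH (lexx _)) _; rewrite addeC.
set X' := X `&` [set x | (m.+2%:R^-1 < f x)%R].
apply: le_trans (hausdorff1_gap X' f1 (mlt _ m0)).
apply: leeD; apply: le_hausdorff1.
  by move=> x [Xx /andP[fx fx']]; split.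
move=> x [Xx /= fx]; split => //; split=> //=; apply: lt_trans fx.
by apply: lt_trans (mlt _ _) (mlt _ _).
Qed.

Let layers_half_le b n :
  \sum_(0 <= k < n) hausdorff1 (layer (k.*2 + b)) <= hausdorff1 X.
Proof.
by apply: le_trans (layers_half b n) _; apply: le_hausdorff1; exact: subIsetl.
Qed.

Let sum_even_odd (u : nat -> \bar R) n : \sum_(0 <= k < n.*2) u k =
  \sum_(0 <= k < n) u (k.*2 + 0)%N + \sum_(0 <= k < n) u (k.*2 + 1)%N.
Proof.
elim: n => [|n IH]; first by rewrite !big_geq// adde0.
by rewrite doubleS !big_nat_recr//= IH addn0 addn1 addeACA addeA.
Qed.

Let layers_lty : \sum_(k <oo) hausdorff1 (layer k) < +oo.
Proof.
apply: (@le_lt_trans _ _ (hausdorff1 X + hausdorff1 X)); last exact: lte_add_pinfty.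
apply: lime_le; first by apply: is_cvg_nneseries => n _ _; exact: hausdorff1_ge0.
apply: nearW => n; apply: (@le_trans _ _ (\sum_(0 <= k < n.*2) hausdorff1 (layer k))).
  rewrite -addnn (big_cat_nat (leq0n n) (leq_addr n n))//= leeDl//.
  by apply: sume_ge0 => k _; exact: hausdorff1_ge0.
by rewrite sum_even_odd leeD.
Qed.

Let positive_part_decomp n : X `&` [set x | (0 < f x)%R] `<=`
  (X `&` [set x | (n.+1%:R^-1 < f x)%R]) `|` \bigcup_k layer (k + n).
Proof.
move=> x [Xx /= fx].
have [nf|nf] := ltP (n.+1%:R^-1)%R (f x); [by left|right].
have [k kf] : exists k, (k.+1%:R^-1 < f x)%R.
  have := @cvg_harmonic R; move/cvgr0Pnorm_lt => /(_ _ fx)[k _ /(_ k (leqnn k))] /=.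
  by rewrite ger0_norm ?invr_ge0//; exists k.
have [m mf mmin] := ex_minnP (ex_intro (fun k => (k.+1%:R^-1 < f x)%R) k kf).
have nm : (n < m)%N.
  rewrite ltnNge; apply: contraL mf => mn; rewrite -leNgt (le_trans nf)//.
  by rewrite lef_pV2 ?posrE ?ltr0n// ler_nat ltnS.
exists (m.-1 - n)%N => //; rewrite subnK; last by rewrite -ltnS (ltn_predK nm).
split=> //=; rewrite (ltn_predK nm) mf/= leNgt.
apply/negP => mf'; have := mmin m.-1; rewrite (ltn_predK nm) => /(_ mf').
by case: m nm {mf mmin mf'} => //= m _; rewrite ltnn.
Qed.

(** The set [0 < f] exceeds [n.+1%:R^-1 < f], to which [hausdorff1_gap] applies, by layers of index
    at least [n] only, and the tails of a convergent series tend to 0. *)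
Lemma hausdorff1_cut0 :
  hausdorff1 (X `&` [set x | (f x <= 0)%R]) +
  hausdorff1 (X `&` [set x | (0 < f x)%R]) <= hausdorff1 X.
Proof.
have tail0 := nneseries_tail_cvg layers_lty (fun k _ => hausdorff1_ge0 (layer k)).
have Hfin : hausdorff1 X \is a fin_num by rewrite ge0_fin_numE ?hausdorff1_ge0.
suff H n : hausdorff1 (X `&` [set x | (f x <= 0)%R]) +
    hausdorff1 (X `&` [set x | (0 < f x)%R]) <=
    hausdorff1 X + \sum_(n <= k <oo) hausdorff1 (layer k).
  have C := cvgeD (fin_num_adde_defr 0 Hfin) (cvg_cst (hausdorff1 X)) tail0.
  rewrite adde0 in C; apply: (cvge_to_ge (C _ _)); exact: nearW.
have -> : \sum_(n <= k <oo) hausdorff1 (layer k) =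
    \sum_(k <oo) hausdorff1 (layer (k + n)).
  rewrite (@nneseries_addn _ (fun k => hausdorff1 (layer k)) n)// => k.
  exact: hausdorff1_ge0.
have n0 : (0 < n.+1%:R^-1 :> R)%R by rewrite invr_gt0.
apply: le_trans (leeD (hausdorff1_gap X f1 n0) (lexx _)).
rewrite -addeA leeD2l//.
apply: le_trans (le_hausdorff1 (@positive_part_decomp n)) _.
apply: le_trans (outer_measureU2 (@hausdorff1_outer R d) _ _) _.
by rewrite leeD2l//; exact: hausdorff1_sigma_subadditive.
Qed.

End Layers.

Lemma lip1_caratheodory (f : E -> R) (c : R) : lip1 f ->
  (@hausdorff1_outer R d).-caratheodory [set x | (c < f x)%R].
Proof.
move=> f1; apply: le_caratheodory_measurable => X.
have [Xoo|Xoo] := eqVneq (hausdorff1 X) +oo.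
  by rewrite [leRHS]Xoo leey.
have Xfin : hausdorff1 X < +oo by rewrite lt_neqAle Xoo leey.
have g1 : lip1 (fun x => f x - c)%R.
  by move=> x y; rewrite opprB addrA subrK.
have := hausdorff1_cut0 g1 Xfin; rewrite addeC.
rewrite (_ : [set x | (0 < f x - c)%R] = [set x | (c < f x)%R]); last first.
  by apply/seteqP; split => x /=; rewrite subr_gt0.
rewrite (_ : [set x | (f x - c <= 0)%R] = ~` [set x | (c < f x)%R]); first by [].
by apply/seteqP; split => x /=; rewrite subr_le0 leNgt => /negP.
Qed.

Lemma lip1_measurable (f : h1space R d -> R) : lip1 f -> measurable_fun setT f.
Proof.
move=> f1 mT; apply: (measurability _ (RGenOInfty.measurableE R)) => //.
move=> _ [_ [c ->] <-]; rewrite setTI.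
rewrite (_ : _ @^-1` _ = [set x | (c < f x)%R]); first exact: lip1_caratheodory.
by apply/seteqP; split => x /=; rewrite in_itv/= andbT.
Qed.

(** An open set is where the 1-Lipschitz distance to its complement is positive. The whole space is
    set apart, since the infimum would run over an empty set. *)
Lemma h1_open_measurable (O : set E) : open O -> measurable (O : set (h1space R d)).
Proof.
move=> oO; have [[z Oz]|C0] := pselect (exists z, ~ O z); last first.
  rewrite (_ : O = setT); first exact: measurableT.
  by apply/seteqP; split => // x _; apply: contrapT => Ox; apply: C0; exists x.
pose D x := [set enorm (x - y) | y in ~` O]%R.
pose f x : R := inf (D x).
have Dlb x : has_lbound (D x) by exists 0%R => _ [y _ <-]; exact: enorm_ge0.
have Dne x : D x !=set0 by exists (enorm (x - z)); exists z.
have f_le x y : (f x - f y <= enorm (x - y))%R.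
  rewrite lerBlDl -lerBlDr; apply: lb_le_inf => // _ [w Ow <-].
  rewrite lerBlDr; apply: (@le_trans _ _ (enorm (x - w))).
    by apply: ge_inf => //; exists w.
  have -> : (x - w = (y - w) + (x - y))%R by rewrite [RHS]addrC addrA subrK.
  exact: enormD.
have f1 : lip1 f.
  by move=> x y; rewrite ler_norml f_le andbT lerNl opprB enormB f_le.
rewrite (_ : O = [set x | (0 < f x)%R]); first exact: lip1_caratheodory.
apply/seteqP; split => x /=.
  move=> Ox; have /nbhs_ballP[e /= e0 eO] : nbhs x O by exact: open_nbhs_nbhs.
  apply: (lt_le_trans e0); apply: lb_le_inf => // _ [y Oy <-].
  rewrite leNgt; apply/negP => xye; apply/Oy/eO.
  by rewrite -ball_normE /ball_/=; exact: le_lt_trans (mx_norm_le_enorm _) xye.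
move=> fx; apply: contrapT => Ox; move: fx; rewrite ltNge => /negP; apply.
by apply: ge_inf => //; exists x => //; rewrite subrr enorm0.
Qed.

Lemma h1_continuous_measurable (f : h1space R d -> R) :
  continuous (f : E -> R) -> measurable_fun setT f.
Proof.
move=> cf mT; apply: (measurability _ (RGenOInfty.measurableE R)) => //.
move=> _ [_ [c ->] <-]; rewrite setTI; apply: h1_open_measurable.
by apply: open_comp; [move=> x _; exact: cf|exact: interval_open].
Qed.

Lemma hausdorff1_set1 (x : E) : hausdorff1 [set x] = 0.
Proof.
apply/eqP; rewrite eq_le hausdorff1_ge0 andbT.
apply: ge_ereal_sup => _ [r r0 <-]; apply: ereal_inf_lbound.
have d0 : diam [set x] = 0.
  apply/eqP; rewrite eq_le diam_ge0 andbT; apply: diam_le => // _ _ -> ->.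
  by rewrite subrr enorm0.
exists (fun=> [set x]); last by apply: eseries0.
split; first by move=> k; rewrite d0 lee_fin ltW.
by move=> y ->; exists 0%N.
Qed.

Lemma countable_hausdorff1 A : countable A -> hausdorff1 A = 0.
Proof.
move=> /pcard_injP[g].
move=> /(@in2W _ _ _ _) gi; apply/eqP; rewrite eq_le hausdorff1_ge0 andbT.
pose B k := A `&` [set x | g x = k].
have AB : A `<=` \bigcup_k B k by move=> x Ax; exists (g x).
apply: le_trans (le_hausdorff1 AB) _.
apply: le_trans (hausdorff1_sigma_subadditive _) _.
rewrite eseries0// => k _ _.
have [[x [Ax gx]]|Bk] := pselect (exists x, B k x); last first.
  rewrite (_ : B k = set0) ?hausdorff1_0//.
  by apply/seteqP; split => // x Bx; case: Bk; exists x.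
rewrite (_ : B k = [set x]) ?hausdorff1_set1//.
apply/seteqP; split => [y [Ay gy]|_ ->]; last by split.
by apply: gi => //; rewrite ?inE// gx gy.
Qed.

Lemma hausdorff1_null_measurable (N : set (h1space R d)) :
  hausdorff1 N = 0 -> measurable N.
Proof.
move=> N0; apply: le_caratheodory_measurable => X.
rewrite [X in X + _](_ : _ = 0) ?add0e; first by apply: le_hausdorff1; exact: subIsetl.
apply/eqP; rewrite eq_le hausdorff1_ge0 andbT -N0.
by apply: le_hausdorff1; exact: subIsetr.
Qed.

End HausdorffMetricOuter.

(** * Hausdorff measure on a line *)

Section HausdorffSegment.
Variables (R : realType) (d : nat).
Notation E := 'rV[R]_d.
Local Open Scope ereal_scope.

(** A 1-Lipschitz map does not increase diameters: it sends a cover of [A] into intervals no longer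
    than the diameters, and these cover []a, b]], so subadditivity of Lebesgue measure concludes. *)
Lemma length_le_hausdorff1 (f : E -> R) (A : set E) (a b : R) : lip1 f ->
  (forall t, (a < t <= b)%R -> exists2 x, A x & f x = t) ->
  (b - a)%:E <= hausdorff1 A.
Proof.
move=> f1 Aab; have [ab|ba] := leP a b; last first.
  by apply: le_trans (hausdorff1_ge0 A); rewrite lee_fin subr_le0 ltW.
apply: le_trans (hausdorff1_pre_le A ltr01); apply: le_ereal_inf_tmp.
move=> _ [F [F1 AF] <-].
have dfin k : diam (F k) \is a fin_num.
  by rewrite ge0_fin_numE ?diam_ge0// (le_lt_trans (F1 k)) ?ltry.
pose I k : set R := if `[< F k !=set0 >]
  then `[inf (f @` F k), (inf (f @` F k) + fine (diam (F k)))%R]%classic else set0.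
have mI k : measurable (I k) by rewrite /I; case: ifP.
have lI k : lebesgue_measure (I k) <= diam (F k).
  rewrite /I; case: ifP => _; last by rewrite measure0 diam_ge0.
  rewrite lebesgue_measure_itv/=; case: ifP => _; last exact: diam_ge0.
  by rewrite -EFinB addrAC subrr add0r fineK.
have cI : `]a, b]%classic `<=` \bigcup_k I k.
  move=> t /=; rewrite in_itv/= => /Aab[x Ax fxt].
  have [k _ Fkx] := AF _ Ax; exists k => //.
  rewrite /I ifT; last by apply/asboolP; exists x.
  have Flow y z : F k y -> F k z -> (f y - fine (diam (F k)) <= f z)%R.
    move=> Fy Fz; have := f1 y z; have := enorm_le_diam Fy Fz.
    rewrite -(fineK (dfin k)) lee_fin => h1 h2.
    by have := le_trans (ler_norm _) (le_trans h2 h1); lra.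
  rewrite /= in_itv/= -fxt; apply/andP; split.
    apply: ge_inf; last by exists x.
    by exists (f x - fine (diam (F k)))%R => _ [y Fy <-]; exact: Flow.
  rewrite -lerBlDr; apply: lb_le_inf; first by exists (f x), x.
  by move=> _ [y Fy <-]; exact: Flow.
apply: (@le_trans _ _ (lebesgue_measure `]a, b]%classic)).
  rewrite lebesgue_measure_itv/= lte_fin; case: ltgtP ab => // ->.
  by rewrite subrr.
apply: le_trans (measure_sigma_subadditive lebesgue_measure mI _ cI) _ => //.
by apply: lee_nneseries => [k _ _|k _]; [exact: measure_ge0|exact: lI].
Qed.

Variables (p v : E).
Hypothesis v1 : enorm v = 1%R.

Definition line (t : R) : E := (p + t *: v)%R.
Definition line_coord (x : E) : R := dotp (x - p)%R v.

Let vv : dotp v v = 1%R. Proof. by rewrite -sqr_enorm v1 expr1n. Qed.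

Lemma lineK : cancel line line_coord.
Proof. by move=> t; rewrite /line_coord /line addrC addKr dotpZl vv mulr1. Qed.

Lemma lip1_line_coord : lip1 line_coord.
Proof.
move=> x y; rewrite /line_coord -dotpBl opprB addrA subrK.
by have := Cauchy_Schwarz_dotp (x - y) v; rewrite v1 mulr1.
Qed.

Lemma enorm_line s t : enorm (line s - line t)%R = `|s - t|%R.
Proof.
by rewrite /line opprD addrACA subrr add0r -scalerBl enormZ v1 mulr1.
Qed.

Lemma hausdorff1_line_le (a b : R) : (a < b)%R ->
  hausdorff1 (line @` `]a, b]%classic) <= (b - a)%:E.
Proof.
move=> ab; apply: ge_ereal_sup => _ [r /= r0 <-].
pose n := Num.truncn ((b - a) / r); pose h := ((b - a) / n.+1%:R)%R.
have ba : (0 < b - a)%R by rewrite subr_gt0.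
have h0 : (0 < h)%R by rewrite divr_gt0.
have hn : (n.+1%:R * h = b - a)%R by rewrite /h mulrCA divff ?pnatr_eq0// mulr1.
have hr : (h <= r)%R.
  have := truncnS_gt ((b - a) / r); rewrite -/n ltr_pdivrMr// => bn.
  by rewrite /h ler_pdivrMr// mulrC ltW.
pose F k := line @` [set t | (k < n.+1)%N /\ (a + k%:R * h <= t <= a + k.+1%:R * h)%R].
have dF k : diam (F k) <= h%:E.
  apply: diam_le => [|_ _ [s [_ /andP[s1 s2]] <-] [t [_ /andP[t1 t2]] <-]].
    exact: ltW.
  rewrite enorm_line ler_norml; move: s1 s2 t1 t2; rewrite -natr1 mulrDl mul1r.
  by clear; lra.
have F0 k : (n.+1 <= k)%N -> diam (F k) = 0.
  move=> nk; rewrite (_ : F k = set0) ?diam0//; apply/seteqP; split => // x [t [kn _] _].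
  by move: kn; rewrite ltnNge nk.
apply: (@le_trans _ _ (\sum_(k <oo) diam (F k))).
  apply: ereal_inf_lbound; exists F => //; split=> [k|_ [t tab <-]].
    by apply: le_trans (dF k) _; rewrite lee_fin.
  move: tab => /=; rewrite in_itv/= => /andP[at_ tb].
  have th0 : (0 <= (t - a) / h)%R by rewrite divr_ge0 ?(ltW h0)// subr_ge0 ltW.
  (* The endpoint [b] goes to the last piece by hand: truncation would give it the index [n.+1], out
     of range. *)
  move: tb; rewrite le_eqVlt => /predU1P[->|tb].
    exists n => //; exists b => //; split => //.
    rewrite hn addrCA subrr addr0 lexx andbT -lerBrDl -hn ler_wpM2r ?(ltW h0)//.
    by rewrite ler_nat.
  have /andP[k1 k2] := truncn_itv th0.
  exists (Num.truncn ((t - a) / h)) => //; exists t => //; split.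
    rewrite ltnS truncn_le_nat.
    by rewrite ltr_pdivrMr// hn ltrD2r.
  move: k1 k2; rewrite ler_pdivlMr// ltr_pdivrMr// => k1 k2.
  by rewrite -lerBrDl k1/= -lerBlDl ltW.
rewrite (@nneseries_split _ _ 0%N n.+1); last by move=> k _; exact: diam_ge0.
rewrite add0n [X in _ + X]eseries0 ?adde0; last by move=> k nk _; exact: F0.
apply: (@le_trans _ _ (\sum_(0 <= k < n.+1) h%:E)).
  by apply: lee_sum => k _; exact: dF.
by rewrite sumEFin lee_fin big_mkord sumr_const card_ord -mulr_natl hn.
Qed.

Lemma hausdorff1_line (a b : R) : (a < b)%R ->
  hausdorff1 (line @` `]a, b]%classic) = (b - a)%:E.
Proof.
move=> ab; apply/eqP; rewrite eq_le hausdorff1_line_le//=.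
apply: (length_le_hausdorff1 lip1_line_coord) => t tab.
by exists (line t); [exists t|exact: lineK].
Qed.

Definition line_set : set (h1space R d) := range line.

Lemma line_setE x : line_set x <-> x = line (line_coord x).
Proof. by split=> [[t _ <-]|->]; [rewrite lineK|exists (line_coord x)]. Qed.

Lemma measurable_line_coord : measurable_fun [set: h1space R d] line_coord.
Proof. exact/lip1_measurable/lip1_line_coord. Qed.

(** By Pythagoras, the line is the zero set of the squared distance to [p] minus the squared
    coordinate along [v]. *)
Lemma measurable_line_set : measurable line_set.
Proof.
pose dist (x : h1space R d) : R := enorm (x - p : E)%R.
have mdist : measurable_fun setT dist.
  apply: lip1_measurable => x y; rewrite /dist ler_norml.
  have H (z w : E) : (enorm (z - p) <= enorm (z - w) + enorm (w - p))%R.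
    have -> : (z - p = (z - w) + (w - p))%R by rewrite addrA subrK.
    exact: enormD.
  have := H x y; have := H y x; rewrite (enormB y x).
  by clear; lra.
pose g (x : h1space R d) : R := (dist x ^+ 2 - line_coord x ^+ 2)%R.
have mg : measurable_fun setT g.
  have ml := measurable_line_coord.
  have mdist2 := measurable_funX 2 mdist.
  have ml2 := measurable_funX 2 ml.
  exact: (measurable_funB mdist2 ml2).
have -> : line_set = g @^-1` [set 0%R].
  apply/seteqP; split => x.
    move=> [t _ <-]; rewrite /= /g lineK /dist sqr_enorm /line addrAC subrr add0r.
    by rewrite dotpZl dotpZr vv mulr1 -expr2 subrr.
  move=> gx; apply/line_setE; apply/eqP; rewrite -subr_eq0 -enorm_eq0 -sqrf_eq0.
  rewrite /line opprD addrA; move: gx; rewrite /= /g /dist /line_coord sqr_enorm.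
  move: (x - p)%R => u gx; rewrite sqr_enorm dotpBl dotpZl (dotpC _ (_ - _)%R).
  rewrite (dotpC v) !dotpBl !dotpZl vv (dotpC v) -[X in _ == X]gx; apply/eqP; ring.
by rewrite -[X in measurable X]setTI; exact: mg.
Qed.

Let muL := mrestr (H1 R d) measurable_line_set.


(* [lebesgue_measure] lives on [measurableTypeR R], whose measurable structure is
   not syntactically the canonical one of [R]. *)
Let nu : {measure set (measurableTypeR R) -> \bar R} :=
  measure_function_pushforward__canonical__measure_function_Measure
  muL (measurable_line_coord : measurable_fun setT
    (line_coord : h1space R d -> measurableTypeR R)).

(** By [hausdorff1_line] the image measure gives each interval []a, b]] its length, which
    characterizes Lebesgue measure. *)
Let pushforward_line (A : set (measurableTypeR R)) : measurable A ->
  lebesgue_measure A = nu A.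
Proof.
apply: (lebesgue_measure_unique (mu := nu)) => _ [[a b] _ <-].
rewrite /= /pushforward /muL /mrestr/=.
have [ab|ba] := ltP a b; last first.
  by rewrite set_itv_ge ?bnd_simp -?leNgt// preimage_set0 set0I !measure0.
rewrite lebesgue_measure_itv/= lte_fin ab -EFinB -hausdorff1_line//.
congr (hausdorff1 _); apply/seteqP; split => [x [t tab <-]|x [xab /line_setE ->]].
  by split; [rewrite /= lineK|exists t].
by exists (line_coord x).
Qed.

Lemma ge0_integral_line (D : set R) (g : R -> \bar R) :
  measurable D -> measurable_fun setT g -> (forall t, 0 <= g t) ->
  \int[H1 R d]_(x in line_coord @^-1` D `&` line_set) g (line_coord x) =
  \int[lebesgue_measure]_(t in D) g t.
Proof.
move=> mD mg g0.
have mlD : measurable (line_coord @^-1` D : set (h1space R d)).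
  by rewrite -[X in measurable X]setTI; exact: measurable_line_coord.
have mL := measurable_line_set.
rewrite -(@eq_measure_integral _ _ _ _ (H1 R d) muL); last first.
  by move=> A mA AS; rewrite /= /muL /mrestr setIidl// => x /AS[].
have gl_meas A : measurable_fun A (g \o (line_coord : h1space R d -> R)).
  apply: measurable_funTS.
  exact: (measurableT_comp mg measurable_line_coord).
(* The change of variables integrates over the whole preimage of [D]; its part off the line is null
   for [muL]. *)
have <- : line_coord @^-1` D `\` ~` line_set = line_coord @^-1` D `&` line_set.
  by rewrite setDE setCK.
rewrite -(@ge0_negligible_integral _ _ _ muL _ _ (g \o line_coord))//; last 2 first.
- by move=> x _; exact: g0.
- by rewrite /= /muL /mrestr setICl hausdorff1_0.
  rewrite [RHS](eq_measure_integral nu); last first.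
    by move=> A mA _; exact: pushforward_line.
  have mgD : measurable_fun (D : set (measurableTypeR R)) g by exact: measurable_funTS.
  apply/esym/(@ge0_integral_pushforward _ _ _ (measurableTypeR R) R
    (line_coord : h1space R d -> measurableTypeR R) measurable_line_coord
    muL D g mD mgD (fun t _ => g0 t)).
exact: measurableC.
Qed.

Lemma integral_line (D : set R) (g : R -> \bar R) :
  measurable D -> measurable_fun setT g ->
  \int[H1 R d]_(x in line_coord @^-1` D `&` line_set) g (line_coord x) =
  \int[lebesgue_measure]_(t in D) g t.
Proof.
move=> mD mg; rewrite integralE [RHS]integralE.
rewrite -(@ge0_integral_line D g^\+)//; last exact: measurable_funepos.
rewrite -(@ge0_integral_line D g^\-)//; last exact: measurable_funeneg.
by congr (_ - _); apply: eq_integral => x _; rewrite ?funeposE ?funenegE.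
Qed.

Lemma integrable_line (D : set R) (g : R -> \bar R) :
  measurable D -> measurable_fun setT g -> lebesgue_measure.-integrable D g ->
  (H1 R d).-integrable (line_coord @^-1` D `&` line_set) (g \o line_coord).
Proof.
move=> mD mg /integrableP[_ ig]; apply/integrableP; split.
  apply: measurable_funTS.
  exact: (measurableT_comp mg measurable_line_coord).
have mag : measurable_fun setT (abse \o g) by exact: measurableT_comp.
by rewrite (ge0_integral_line mD mag (fun t => abse_ge0 _)).
Qed.

End HausdorffSegment.

(** * Currents carried by segments *)

Section DirectionalC1.
Variables (R : realType) (V : normedModType R).

Lemma MVT_from0 (F dF : R -> R) (h : R) :
  (forall s : R, is_derive s 1 F (dF s)) ->
  exists2 c, `|c| <= `|h| & F h - F 0 = dF c * h.
Proof.
move=> dFP.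
have cF (a b : R) : {within `[a, b], continuous F}.
  apply: derivable_within_continuous => s _.
  exact: (@ex_derive _ _ _ _ _ _ _ (dFP s)).
have [h0|h0|->] := ltgtP h 0.
- have [c] := MVT h0 (fun s _ => dFP s) (cF h 0).
  rewrite in_itv/= => /andP[hc c0]; rewrite sub0r => E.
  exists c; first by rewrite !ltr0_norm// lerN2 ltW.
  by rewrite -opprB E mulrN opprK.
- have [c] := MVT h0 (fun s _ => dFP s) (cF 0 h).
  rewrite in_itv/= => /andP[c0 ch]; rewrite subr0 => E.
  by exists c => //; rewrite !gtr0_norm// ltW.
- by exists 0 => //; rewrite subrr mulr0.
Qed.

(** Only the derivative along [w] has to be continuous: the increment along [w] starts from the
    moving point [x + h *: u], and the mean value theorem turns it into a value of [g] near [x]. *)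
Lemma is_derive_dirD (f g : V -> R) (x u w : V) (a : R) :
  (forall y, is_derive y w f (g y)) -> {for x, continuous g} ->
  is_derive x u f a -> is_derive x (u + w) f (a + g x).
Proof.
move=> df cg [du <-].
pose q1 (h : R) : R := h^-1 *: ((f \o shift x) (h *: u) - f x).
pose q2 (h : R) : R := h^-1 * (f (x + h *: u + h *: w) - f (x + h *: u)).
have qE (h : R) : h^-1 *: ((f \o shift x) (h *: (u + w)) - f x) = q1 h + q2 h.
  rewrite -[LHS]/(h^-1 * (f (h *: (u + w) + x) - f x)).
  rewrite -[q1 h]/(h^-1 * (f (h *: u + x) - f x)) /q2.
  have -> : h *: (u + w) + x = x + h *: u + h *: w.
    by rewrite scalerDr addrC addrA.
  by rewrite [h *: u + x]addrC; ring.
have cq1 : q1 @ 0^' --> 'D_u f x by exact: du.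
have cq2 : q2 @ 0^' --> g x.
  apply/cvgrPdist_lt => e e0.
  have /cvgrPdist_lt /(_ e e0) /nbhs_ballP[r /= r0 gr] := cg.
  have uw0 : 0 < `|u| + `|w| + 1 by rewrite ltr_wpDl// addr_ge0.
  near=> h.
  have h0 : h != 0 by near: h; exact: nbhs_dnbhs_neq.
  have [c ch E] := @MVT_from0 (fun s => f (x + h *: u + s *: w))
    (fun s => g (x + h *: u + s *: w)) h
    (fun s => (is_derive_line f (x + h *: u) w s _).2 (df _)).
  have -> : q2 h = g (x + h *: u + c *: w).
    by rewrite /q2 -[f (x + h *: u) in X in _ * X]addr0; move: E;
      rewrite scale0r addr0 addr0 => ->; rewrite mulrC mulfK.
  apply: gr; rewrite -ball_normE /ball_/= -addrA opprD addrA subrr add0r normrN.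
  have : `|h| < r / (`|u| + `|w| + 1).
    by near: h; apply: dnbhs0_lt; rewrite divr_gt0.
  rewrite ltr_pdivlMr//; apply: le_lt_trans.
  apply: le_trans (ler_normD _ _) _; rewrite !normrZ 2!mulrDr mulr1 -addrA lerD2l.
  by rewrite ler_wpDr// ler_wpM2r.
have cq : (fun h : R => h^-1 *: ((f \o shift x) (h *: (u + w)) - f x)) @ 0^' -->
    'D_u f x + g x.
  by rewrite (funext qE); exact: cvgD.
by split; [apply/cvg_ex; exists ('D_u f x + g x)|exact/cvg_lim].
Unshelve. all: by end_near. Qed.

Lemma is_derive_dirZ (f : V -> R) (x u : V) (k a : R) :
  is_derive x u f a -> is_derive x (k *: u) f (k * a).
Proof.
move=> du.
have x0 : x = x + 0 *: (k *: u) by rewrite scale0r addr0.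
rewrite x0; apply/is_derive_line.
have dl : is_derive (k * 0 : R) 1 (fun s : R => f (x + s *: u)) a.
  by apply/is_derive_line; rewrite mulr0 scale0r addr0.
have dk : is_derive (0 : R) 1 (fun s : R => k * s) k.
  apply: (is_derive_eq (is_deriveZ k (is_derive_id (0 : R) 1))).
  by rewrite -[_ *: _]/(_ * _) mulr1.
have := is_derive_comp1 dl dk; rewrite mulrC.
by congr is_derive; apply/funext => s /=; rewrite scalerA [s * k]mulrC.
Qed.

End DirectionalC1.

Section Segment.
Variables (R : realType) (d : nat).
Notation E := 'rV[R]_d.

Lemma testfun_continuous (f : testfun R d) : continuous f.
Proof. exact: ((testfunP f).1 [::]).1. Qed.

Lemma testfun_bounded (f : testfun R d) : exists M, forall x, `|f x| <= M.
Proof.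
have [_ cf] := testfunP f.
have cfK : {within closure [set x | f x != 0], continuous f}.
  by apply: continuous_subspaceT; exact: testfun_continuous.
have [M [_ fM]] := compact_bounded (continuous_compact cfK cf).
exists (`|M| + 1) => x.
have [->|fx] := eqVneq (f x) 0; first by rewrite normr0 addr_ge0.
apply: fM; first by rewrite ltr_pwDr// ler_norm.
by exists x => //; exact: subset_closure.
Qed.

(** Smoothness only speaks of partial derivatives; adding one coordinate direction at a time yields
    all directional derivatives. *)
Lemma is_derive_testfun (f : testfun R d) (x v : E) :
  is_derive x v f (dotp (form1_at (ext_d f) x) v).
Proof.
have df i (y : E) : is_derive y (delta_mx 0 i : E) f (dpartial i f y).
  by split => //; exact: ((testfunP f).1 [::]).2.
suff H (s : seq 'I_d) : is_derive x (\sum_(i <- s) v 0 i *: (delta_mx 0 i : E)) f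
    (\sum_(i <- s) v 0 i * dpartial i f x).
  rewrite [v in is_derive _ v](row_sum_delta v).
  apply: (is_derive_eq (H _)).
  by apply: eq_bigr => i _; rewrite mxE ffunE mulrC.
elim: s => [|i s IH]; first by rewrite !big_nil; exact: is_derive0.
rewrite !big_cons addrC [X in is_derive _ _ _ X]addrC.
apply: (is_derive_dirD (g := fun y => v 0 i * dpartial i f y)) => //.
  by move=> y; exact: is_derive_dirZ.
by apply: continuousM; [exact: cst_continuous|exact: testfun_continuous].
Qed.

Lemma continuous_line (p v : E) : continuous (line p v).
Proof.
move=> t; apply: (@continuousD _ _ _ (cst p) (fun s : R => s *: v)).
  exact: cst_continuous.
exact: scalel_continuous.
Qed.

Lemma continuous_form1_dotp (w : form1 R d) (p v : E) :
  continuous (fun t : R => dotp (form1_at w (line p v t)) v).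
Proof.
rewrite (_ : (fun _ => _) =
  \sum_(i < d) ((w i : E -> R) \o line p v) * cst (v 0 i)); last first.
  by apply/funext => t; rewrite fct_sumE; apply: eq_bigr => i _; rewrite mxE.
elim/big_ind: _ => [t|f g cf cg t|i _ t]; first exact: cst_continuous.
  by apply: continuousD; [exact: cf|exact: cg].
apply: continuousM; last exact: cst_continuous.
by apply: continuous_comp; [exact: continuous_line|exact: testfun_continuous].
Qed.

Variables (p v : E) (l : R).
Hypotheses (v1 : enorm v = 1) (l0 : 0 < l).

Definition segment_fun (w : form1 R d) : R :=
  \int[lebesgue_measure]_(t in `[0, l]) dotp (form1_at w (line p v t)) v.

Lemma integrable_form1_dotp (w : form1 R d) :
  lebesgue_measure.-integrable `[0, l]%classic
    (EFin \o (fun t : R => dotp (form1_at w (line p v t)) v)).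
Proof.
apply: continuous_compact_integrable; first exact: segment_compact.
exact/continuous_subspaceT/continuous_form1_dotp.
Qed.

Lemma segment_fun_linear : scalar segment_fun.
Proof.
move=> a w1 w2; rewrite /segment_fun.
rewrite -RintegralZl//; last exact: integrable_form1_dotp.
rewrite -RintegralD//; last 2 first.
- have := integrable_form1_dotp (a *: w1); congr (_.-integrable _ _).
  apply/funext => t /=; congr EFin; rewrite -dotpZl; congr dotp.
  by apply/rowP => i; rewrite !mxE ffunE.
- exact: integrable_form1_dotp.
apply: eq_Rintegral => t _; rewrite -dotpZl -dotpDl; congr dotp.
by apply/rowP => i; rewrite !mxE !ffunE.
Qed.

Lemma segment_fun_le (w : form1 R d) (M : R) :
  (forall z, `|dotp (form1_at w z) v| <= M) -> `|segment_fun w| <= l * M.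
Proof.
move=> wM; apply: le_trans (le_normr_Rintegral _ (integrable_form1_dotp w)) _.
  exact: measurable_itv.
have mI : measurable `[0, l]%classic by exact: measurable_itv.
have -> : l * M = \int[lebesgue_measure]_(t in `[0, l]) M.
  have leb : lebesgue_measure `[0, l]%classic = l%:E.
    by rewrite lebesgue_measure_itv/= lte_fin l0 oppr0 adde0.
  rewrite (Rintegral_cst lebesgue_measure mI) mulrC; congr (_ * _).
  by apply: esym; exact: (congr1 fine leb).
apply: le_Rintegral => //.
  exact: (integrable_abse (integrable_form1_dotp w)).
apply: continuous_compact_integrable; first exact: segment_compact.
exact/continuous_subspaceT/cst_continuous.
Qed.

HB.instance Definition _ := GRing.isLinear.Build R (form1 R d) R *%R
  segment_fun segment_fun_linear.

Lemma segment_fun_continuous : continuous1 segment_fun.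
Proof.
move=> K _; exists 0%N, (l * \sum_i `|v 0 i|) => w M _ wM.
rewrite -mulrA; apply: segment_fun_le => z.
apply: le_trans (ler_norm_sum _ _ _) _; rewrite mulr_suml.
apply: ler_sum => i _; rewrite mxE normrM mulrC ler_wpM2l//.
exact: (wM [::]).
Qed.

Definition segment_current : current1 R d := Current1 segment_fun_continuous.

Lemma boundary_segment (f : testfun R d) :
  boundary segment_current f = f (line p v l) - f p.
Proof.
rewrite /= /boundary_fun /= /segment_fun.
pose g t := dotp (form1_at (ext_d f) (line p v t)) v.
have dF (t : R) : is_derive t 1 (fun s : R => f (line p v s)) (g t).
  by apply/is_derive_line; exact: is_derive_testfun.
have cF : continuous (fun s : R => f (line p v s)).
  by move=> t; apply/differentiable_continuous/derivable1_diffP;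
    exact: (@ex_derive _ _ _ _ _ _ _ (dF t)).
rewrite /Rintegral (@continuous_FTC2 _ g (fun s : R => f (line p v s)))//.
- by rewrite /= /line scale0r addr0.
- exact/continuous_subspaceT/continuous_form1_dotp.
- split; [by move=> t _; case: (dF t)|exact: cvg_at_right_filter (cF 0)
    |exact: cvg_at_left_filter (cF l)].
- by move=> t _; rewrite derive1E; apply: derive_val.
Qed.

Lemma segment_current_le (w : form1 R d) :
  (forall z, enorm (form1_at w z) <= 1) -> segment_current w <= l.
Proof.
move=> w1; rewrite -[leRHS]mulr1; apply: le_trans (ler_norm _) _.
apply: segment_fun_le => z; apply: le_trans (Cauchy_Schwarz_dotp _ _) _.
by rewrite v1 mulr1.
Qed.

Definition segment_set : set (h1space R d) :=
  line_coord p v @^-1` `[0, l]%classic `&` line_set p v.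

Lemma measurable_segment_set : measurable segment_set.
Proof.
apply: measurableI; last exact: measurable_line_set.
rewrite -[X in measurable X]setTI; exact: (measurable_line_coord p v1).
Qed.

Lemma segment_currentE (w : form1 R d) : segment_current w =
  \int[H1 R d]_(x in segment_set) dotp (form1_at w x) v.
Proof.
pose g (t : R) := (dotp (form1_at w (line p v t)) v)%:E.
have mg : measurable_fun setT g.
  apply/measurable_EFinP; apply: continuous_measurable_fun.
  exact: continuous_form1_dotp.
rewrite /= /segment_fun /Rintegral.
have mI : measurable `[0, l]%classic by exact: measurable_itv.
have := @integral_line _ _ p v v1 _ g mI mg; rewrite /g => <-.
congr fine; apply: eq_integral => x /[!inE] -[_ /(line_setE p v1) xE].
by rewrite -xE.
Qed.

Lemma integrable_segment1 :
  (H1 R d).-integrable segment_set (fun x => 1%:E).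
Proof.
have mI : measurable `[0, l]%classic by exact: measurable_itv.
have := @integrable_line R d p v v1 _ (fun=> 1%:E) mI; apply.
  exact: measurable_cst.
apply: (@continuous_compact_integrable _ (fun=> 1)); first exact: segment_compact.
exact/continuous_subspaceT/cst_continuous.
Qed.

End Segment.

(** * Integer rectifiability of sums of segments *)

Section MergeIntegrals.
Context d (T : measurableType d) (R : realType).
Variable mu : {measure set T -> \bar R}.
Variables (A B : set T) (f g F : T -> R).
Hypotheses (mA : measurable A) (mB : measurable B).
Hypotheses (intf : mu.-integrable A (EFin \o f)).
Hypotheses (intg : mu.-integrable B (EFin \o g)).
Hypothesis FE : {in A `|` B, forall x, F x = (f \_ A) x + (g \_ B) x}.

Let FU : F \_ (A `|` B) = (fun x => (f \_ A) x + (g \_ B) x).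
Proof.
apply/funext => x; rewrite patchE; case: ifPn => [|xAB]; first exact: FE.
move: xAB; rewrite in_setU negb_or => /andP[/negPf xA /negPf xB].
by rewrite !patchE xA xB addr0.
Qed.

Let intfA : mu.-integrable setT (EFin \o (f \_ A)).
Proof.
by rewrite -restrict_EFin; apply/(integrable_mkcond (EFin \o f) mA).
Qed.

Let intgB : mu.-integrable setT (EFin \o (g \_ B)).
Proof.
by rewrite -restrict_EFin; apply/(integrable_mkcond (EFin \o g) mB).
Qed.

Lemma integrable_merge : mu.-integrable (A `|` B) (EFin \o F).
Proof.
apply/(integrable_mkcond (EFin \o F) (measurableU _ _ mA mB)).
rewrite restrict_EFin FU.
exact: (integrableD measurableT intfA intgB).
Qed.

(** [A] and [B] may overlap, and there [F] is the sum of both integrands; extension by 0 reduces the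
    claim to additivity on the whole space. *)
Lemma Rintegral_merge :
  \int[mu]_(x in A `|` B) F x = \int[mu]_(x in A) f x + \int[mu]_(x in B) g x.
Proof.
rewrite Rintegral_mkcond FU RintegralD//.
by rewrite -!Rintegral_mkcond.
Qed.

End MergeIntegrals.

Section TransverseCurves.
Variables (R : realType) (d : nat).
Notation E := 'rV[R]_d.

(* Where a curve crosses a line transversally, the parameter is isolated among
   those sent to the line. *)
Lemma transverse_countable (p v : E) (gamma : R -> E) : enorm v = 1 ->
  countable [set x | line_set p v x /\ exists t : R,
      [/\ gamma t = x, derivable gamma t 1, 'D_1 gamma t != 0 &
          forall c : R, 'D_1 gamma t != c *: v]].
Proof.
move=> v1; pose P : set R := [set t | line_set p v (gamma t)].
apply: (@sub_countable _ _ _ (gamma @` isolated P)); last first.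
  exact: sub_countable (card_image_le _ _) (countable_isolated P).
apply: subset_card_le => x [Lx [t [gt dt _ Dt]]].
exists t => //; split; first by rewrite inE /P/= gt.
set D := 'D_1 gamma t in Dt.
pose q (h : R) := h^-1 *: ((gamma \o shift t) (h *: 1) - gamma t).
have qD : q @ 0^' --> D by exact: dt.
have [i Di] : exists i, (D - dotp D v *: v) 0 i != 0.
  apply: contrapT => noD; have /negP := Dt (dotp D v); apply.
  rewrite -subr_eq0; apply/eqP/rowP => i; rewrite [RHS]mxE.
  by apply: contrapT => /eqP Di; apply: noD; exists i.
(* [k] is a coordinate of the component orthogonal to [v]. It is constant on the line, whereas its
   rate of change along [gamma] at [t] is [k D], which is nonzero; so [gamma] leaves the line around
   [t]. *)
pose k (y : E) : R := y 0 i - dotp y v * v 0 i.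
have ck : continuous k.
  have -> : k = (fun y : E => y 0 i) +
      (\sum_(j < d) (fun y : E => y 0 j) * cst (v 0 j)) * cst (- v 0 i).
    by apply/funext => y; rewrite /k /dotp !fctE fct_sumE /= mulrN.
  move=> y; apply: continuousD; first exact: (@coord_continuous R 1 d 0 i).
  apply: continuousM; last exact: cst_continuous.
  elim/big_ind: _ => [|f g cf cg|j _]; first exact: cst_continuous.
    by apply: continuousD.
  by apply: continuousM; [exact: (@coord_continuous R 1 d 0 j)|exact: cst_continuous].
have kD : k D != 0 by move: Di; rewrite !mxE.
have kB y z : k (y - z) = k y - k z.
  by rewrite /k dotpBl !mxE; ring.
have kZ c y : k (c *: y) = c * k y.
  by rewrite /k dotpZl !mxE; ring.
have kline s : k (line p v s) = k p.
  apply/eqP; rewrite -subr_eq0 -kB /k -/(line_coord p v _) lineK// /line.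
  by rewrite addrAC subrr add0r !mxE subrr.
have kq : k \o q @ 0^' --> k D by apply: continuous_cvg => //; exact: ck.
have near0 : \forall h \near 0^', k (q h) != 0.
  have : nbhs (k D) [set r : R | r != 0].
    by apply: open_nbhs_nbhs; split; [exact: open_neq|].
  by move=> /kq.
have [e /= e0 eP] := near0.
exists (ball t e); first exact: nbhsx_ballx.
apply/seteqP; split => [s [/= ts Ps]|s ->]; last first.
  by split; [exact: ballxx|rewrite /P/= gt].
apply: contrapT => st.
have : k (q (s - t)) != 0.
  apply: eP; last by rewrite subr_eq0; apply/eqP.
  by rewrite /= sub0r normrN distrC; exact: ts.
rewrite /q kZ /= -[(s - t) *: 1]/((s - t) * 1) mulr1 subrK gt.
move: Ps Lx; rewrite /P /= => -[s' _ <-] [t' _ <-].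
by rewrite kB !kline subrr mulr0 eqxx.
Qed.

End TransverseCurves.

Section IntegerRectifiable.
Variables (R : realType) (d : nat).
Notation E := 'rV[R]_d.
Local Notation H1 := (H1 R d).

Lemma integrable_form1 (A : set (h1space R d)) (tau : h1space R d -> E)
    (theta : h1space R d -> R) (w : form1 R d) :
  measurable A -> (forall x, A x -> enorm (tau x) = 1) ->
  (forall i, measurable_fun A (fun x => tau x 0 i)) ->
  H1.-integrable A (EFin \o theta) ->
  H1.-integrable A (EFin \o (fun x => dotp (form1_at w x) (tau x) * theta x)).
Proof.
move=> mA tau1 mtau itheta.
have [M wM] : {M : 'I_d -> R & forall i x, `|w i x| <= M i}.
  exact: (choice (fun i => testfun_bounded (w i))).
pose C := \sum_i M i.
have mtheta : measurable_fun A theta.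
  exact/measurable_EFinP/(measurable_int H1 itheta).
have mdot : measurable_fun A (fun x => dotp (form1_at w x) (tau x)).
  apply: measurable_sum => i.
  have mw : measurable_fun A (w i : h1space R d -> R).
    exact/measurable_funTS/h1_continuous_measurable/testfun_continuous.
  rewrite (_ : (fun _ => _) = (fun x => w i x * tau x 0 i)).
    exact: (measurable_funM mw (mtau i)).
  by apply/funext => x; rewrite mxE.
have mF : measurable_fun A (EFin \o (fun x => dotp (form1_at w x) (tau x) * theta x)).
  exact/measurable_EFinP/(measurable_funM mdot mtheta).
apply: (@le_integrable _ _ _ H1 A mA _ (fun x => C%:E * (theta x)%:E)%E mF).
  move=> x Ax; rewrite -EFinM lee_fin !normrM ler_wpM2r//.
  apply: le_trans (ler_norm_sum _ _ _) (le_trans _ (ler_norm _)).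
  apply: ler_sum => i _; rewrite mxE normrM -[leRHS]mulr1.
  apply: ler_pM => //; rewrite -(tau1 x Ax).
  exact: normr_coord_le_enorm.
exact: (integrableZl mA C itheta).
Qed.

Lemma integer_rectifiable1_mass (T : current1 R d) :
  integer_rectifiable1 T -> (mass1 T < +oo)%E.
Proof.
move=> [A [tau [theta [mA _ [[tau1 _] mtau] itheta TE]]]].
apply: (@le_lt_trans _ _ (\int[H1]_(x in A) `|(theta x)%:~R|)%:E); last exact: ltry.
apply: ge_ereal_sup => _ [w /= w1 <-]; rewrite lee_fin TE.
have iw := integrable_form1 (theta := fun x => (theta x)%:~R) w mA tau1 mtau itheta.
apply: le_trans (ler_norm _) (le_trans (le_normr_Rintegral mA iw) _).
apply: (le_Rintegral mA (integrable_abse iw) (integrable_abse itheta)) => x Ax.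
rewrite normrM ler_piMl//; apply: le_trans (Cauchy_Schwarz_dotp _ _) _.
by rewrite tau1// mulr1.
Qed.

Lemma lipschitz_line (p v : E) : lipschitz (line p v).
Proof.
exists `|v|; split; first exact: num_real.
move=> M vM [s t] _ /=; rewrite /line opprD addrACA subrr add0r -scalerBl.
by rewrite normrZ mulrC ler_wpM2r// ltW.
Qed.

Lemma is_derive_line_map (p v : E) (t : R) : is_derive t 1 (line p v) v.
Proof.
have lim_quot : (fun h : R => h^-1 *: ((line p v \o shift t) (h *: (1 : R)) - line p v t))
    @ 0^' --> v.
  apply: cvg_near_cst; near=> h.
  have h0 : h != 0 by near: h; exact: nbhs_dnbhs_neq.
  rewrite /= /line opprD addrACA subrr add0r -scalerBl addrK scalerA.
  by rewrite -[h *: 1]/(h * 1) mulr1 mulVf// scale1r.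
by split; [apply/cvg_ex; exists v|exact/cvg_lim].
Unshelve. all: by end_near. Qed.

Lemma unit_collinear (u v : E) (c : R) :
  enorm u = 1 -> enorm v = 1 -> v = c *: u -> u = v \/ u = - v.
Proof.
move=> u1 v1 vE; have : `|c| = 1 by rewrite -v1 vE enormZ u1 mulr1.
move=> c1; have [c0|c0] := leP 0 c.
  by left; rewrite vE -(ger0_norm c0) c1 scale1r.
right; rewrite vE -[c]opprK -(ltr0_norm c0) c1.
by rewrite scaleN1r opprK.
Qed.

Lemma hausdorff1_setU_null (A B : set E) :
  hausdorff1 A = 0%E -> hausdorff1 B = 0%E -> hausdorff1 (A `|` B) = 0%E.
Proof.
move=> A0 B0; apply/eqP; rewrite eq_le hausdorff1_ge0 andbT.
have := outer_measureU2 (@hausdorff1_outer R d) A B.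
by rewrite /= A0 B0 adde0.
Qed.

Section AddSegment.
Variables (p v : E) (l : R).
Hypotheses (v1 : enorm v = 1) (l0 : 0 < l).
Variables (A : set (h1space R d)) (tau : h1space R d -> E).
Variable theta : h1space R d -> int.
Hypotheses (mA : measurable A) (rA : rectifiable_set A) (oA : orients A tau).
Hypothesis mtau : forall i, measurable_fun A (fun x => tau x 0 i).
Hypothesis itheta : H1.-integrable A (fun x => (theta x)%:~R%:E).

Let S := segment_set p v l.
(* The orientation axiom of [A], applied to the line carrying [S], makes this
   overlap null: elsewhere on [A `&` S] the two orientations agree up to sign,
   and [dotp tau' v] is the sign with which [S] contributes to the
   multiplicity. *)
Let N := [set x | [/\ A x, S x, tau x <> v & tau x <> - v]].

Let N0 : hausdorff1 N = 0%E.
Proof.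
apply/eqP; rewrite eq_le hausdorff1_ge0 andbT -(oA.2 _ (lipschitz_line p v)).
apply: le_hausdorff1 => x [Ax [_ Lx] xv xNv]; split => //.
have [t _ tx] := Lx; exists t; have := is_derive_line_map p v t => -[dt Dt].
have v0 : v != 0 by rewrite -enorm_eq0 v1 oner_neq0.
split=> //; rewrite Dt//; move=> c; apply/eqP => vE.
by have [] := unit_collinear (oA.1 x Ax) v1 vE.
Qed.

Let mN : measurable (N : set (h1space R d)).
Proof. exact: hausdorff1_null_measurable. Qed.

Let A' := A `\` N.
Let S' := S `\` N.
(** The old orientation prevails on the overlap, so that old multiplicities stay and only the new
    segment carries a sign. *)
Let tau' (x : h1space R d) : E := if x \in A then tau x else v.
Let h (x : h1space R d) : R := dotp (tau' x) v.
Let theta' (x : h1space R d) : int :=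
  (if x \in A' then theta x else 0) +
  (if x \in S' then if 0 < h x then 1 else - 1 else 0).

Let mS : measurable S. Proof. exact: measurable_segment_set. Qed.
Let mA' : measurable A'. Proof. exact: measurableD. Qed.
Let mS' : measurable S'. Proof. exact: measurableD. Qed.

Let tau'A x : A x -> tau' x = tau x.
Proof. by move=> Ax; rewrite /tau' mem_set. Qed.

Let tau'S x : S' x -> tau' x = v \/ tau' x = - v.
Proof.
move=> [Sx Nx]; rewrite /tau'; case: ifPn => [/[!inE] Ax|]; last by left.
have [|xv] := pselect (tau x = v); [by left|right].
by apply: contrapT => xNv; apply: Nx.
Qed.

Let vv : dotp v v = 1. Proof. by rewrite -sqr_enorm v1 expr1n. Qed.

Let theta'E x : (theta' x)%:~R =
  ((fun y => (theta y)%:~R) \_ A') x + (h \_ S') x :> R.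
Proof.
rewrite /theta' !patchE intrD; congr (_ + _); first by case: ifP.
case: ifPn => // /[!inE] Sx; rewrite /h.
have [->|->] := tau'S Sx; first by rewrite vv ltr01.
by rewrite dotpNl vv oppr_gt0 ltNge ler01.
Qed.

Let form_theta'E (w : form1 R d) x :
  dotp (form1_at w x) (tau' x) * (theta' x)%:~R =
  ((fun y => dotp (form1_at w y) (tau y) * (theta y)%:~R) \_ A') x +
  ((fun y => dotp (form1_at w y) v) \_ S') x.
Proof.
rewrite theta'E mulrDr !patchE; congr (_ + _).
  by case: ifPn => [/[!inE] -[/tau'A ->]//|_]; rewrite mulr0.
case: ifPn => [/[!inE] Sx|_]; last by rewrite mulr0.
rewrite /h; have [->|->] := tau'S Sx; first by rewrite vv mulr1.
by rewrite (dotpC _ (- v)) !dotpNl vv (dotpC v) mulrN1 opprK.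
Qed.

(** On these disjoint pieces [tau'] is [tau] and the constant [v] respectively, which gives its
    measurability. *)
Let ASE : A' `|` S' = A' `|` (S `\` A).
Proof.
apply/seteqP; split => x [|]; [by left| |by left|].
  move=> [Sx Nx]; have [Ax|Ax] := pselect (A x); [by left; split|by right; split].
by move=> [Sx Ax]; right; split => // -[].
Qed.

Let mtau' i : measurable_fun (A' `|` S') (fun x => tau' x 0 i).
Proof.
rewrite ASE; apply/(measurable_funU _ mA' (measurableD mS mA)); split.
  apply: (eq_measurable_fun (fun x => tau x 0 i)).
    by move=> x /[!inE] -[Ax _]; rewrite tau'A.
  exact: (measurable_funS mA (@subDsetl _ _ _) (mtau i)).
apply: (eq_measurable_fun (cst (v 0 i))); last exact: measurable_cst.
by move=> x /[!inE] -[_ nAx]; rewrite /tau' ifF//; apply/negP => /[!inE].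
Qed.

Let ih : H1.-integrable S' (EFin \o h).
Proof.
have mh : measurable_fun S' h.
  apply: measurable_sum => i.
  have mti := measurable_funS (measurableU _ _ mA' mS') (@subsetUr _ _ _) (mtau' i).
  exact: (measurable_funM mti (measurable_cst _)).
have mEh : measurable_fun S' (EFin \o h) by exact/measurable_EFinP.
have i1 := integrableS mS mS' (@subDsetl _ _ _) (integrable_segment1 p l v1).
apply: (@le_integrable _ _ _ H1 S' mS' _ (fun=> 1%:E) mEh _ i1) => x Sx.
rewrite lee_fin normr1 /h.
by have [->|->] := tau'S Sx; rewrite ?dotpNl ?normrN vv normr1.
Qed.

Let itheta' : H1.-integrable (A' `|` S') (fun x => (theta' x)%:~R%:E).
Proof.
have i1 := integrableS mA mA' (@subDsetl _ _ _) itheta.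
exact: (integrable_merge (F := fun x => (theta' x)%:~R) mA' mS' i1 ih
  (fun x _ => theta'E x)).
Qed.

Let otau' : orients (A' `|` S') tau'.
Proof.
split=> [x [[Ax _]|Sx]|gamma lg].
- by rewrite tau'A// oA.1.
- by have [->|->] := tau'S Sx; rewrite ?enormN.
(* Exceptional points in [A] form a null set by the orientation of [A]. The others lie on the line,
   where [tau'] is [v], and are transverse crossings, hence countable. *)
have SN := countable_hausdorff1 (transverse_countable p gamma v1).
have := hausdorff1_setU_null (oA.2 _ lg) SN => U0.
apply/eqP; rewrite eq_le hausdorff1_ge0 andbT -U0.
apply: le_hausdorff1 => x [ASx [t [gt dt Dt0 Dt]]].
have [Ax|Ax] := pselect (A x).
  left; split => //; exists t; split => // c; rewrite -tau'A//; exact: Dt.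
right; split; first by move: ASx => [[//]|[[_ Lx] _]].
exists t; split => // c.
have := Dt c; rewrite /tau' ifF//; apply/negP => /[!inE].
exact: Ax.
Qed.

Let rAS : rectifiable_set (A' `|` S').
Proof.
have [gamma [lg Ag]] := rA.
exists (fun k => if k is k'.+1 then gamma k' else line p v); split.
  by case=> [|k]; [exact: lipschitz_line|exact: lg].
apply/eqP; rewrite eq_le hausdorff1_ge0 andbT -Ag; apply: le_hausdorff1.
move=> x [[[Ax _]|[[_ Lx] _]] ng]; last by case: ng; exists 0%N.
by split=> // -[k _ gx]; apply: ng; exists k.+1.
Qed.

Lemma integer_rectifiable1_add_segment (T U : current1 R d) :
  (forall w : form1 R d, T w =
     \int[H1]_(x in A) (dotp (form1_at w x) (tau x) * (theta x)%:~R)) ->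
  (forall w, U w = T w + segment_current p v l0 w) ->
  integer_rectifiable1 U.
Proof.
move=> TE UE; exists (A' `|` S'), tau', theta'; split=> //.
  exact: measurableU.
move=> w.
have iA := integrable_form1 (theta := fun x => (theta x)%:~R) w mA oA.1 mtau itheta.
have iS : H1.-integrable S (EFin \o (fun x => dotp (form1_at w x) v)).
  have := @integrable_form1 S (cst v) (cst 1) w mS (fun _ _ => v1)
    (fun i => measurable_cst _) (integrable_segment1 p l v1).
  by congr (_.-integrable _ _); apply/funext => x /=; rewrite mulr1.
have N0' : H1 N = 0%E by exact: N0.
rewrite UE TE segment_currentE// /Rintegral.
rewrite (negligible_integral mN mA iA N0') (negligible_integral mN mS iS N0').
have iA' := integrableS mA mA' (@subDsetl _ _ _) iA.
have iS' := integrableS mS mS' (@subDsetl _ _ _) iS.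
exact/esym/(Rintegral_merge mA' mS' iA' iS' (fun x _ => form_theta'E w x)).
Qed.

End AddSegment.

End IntegerRectifiable.

(** * Optimal integral currents *)

Section OptimalCurrent.
Variables (R : realType) (d : nat).
Notation E := 'rV[R]_d.

Lemma current1_add (S T : current1 R d) :
  exists U : current1 R d, forall w, U w = S w + T w.
Proof.
have c : continuous1 (S \+ T).
  move=> K cK; have [N1 [C1 H1]] := current1_continuous S cK.
  have [N2 [C2 H2]] := current1_continuous T cK.
  exists (maxn N1 N2), (C1 + C2) => w M wK wM; rewrite mulrDl.
  apply: le_trans (ler_normD _ _) (lerD _ _).
    by apply: H1 => // s i x sN; apply: wM; rewrite leq_max sN.
  by apply: H2 => // s i x sN; apply: wM; rewrite leq_max sN orbT.
by exists (Current1 c).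
Qed.

Lemma current1_zero : exists T : current1 R d,
  (forall w, T w = 0) /\ integer_rectifiable1 T.
Proof.
have c : continuous1 (\0 : form1 R d -> R).
  by move=> K _; exists 0%N, 0 => w M _ _; rewrite normr0 mul0r.
exists (Current1 c); split => //.
exists set0, (cst 0), (cst 0); split => //.
- exists (fun=> line 0 0); split; first by move=> k; exact: lipschitz_line.
  by rewrite set0D; exact: hausdorff1_0.
- split; last by move=> i; exact: measurable_fun_set0.
  split=> // gamma _; rewrite (_ : mkset _ = set0) ?hausdorff1_0//.
  by apply/seteqP; split => // x [].
- exact: integrable_set0.
- by move=> w; rewrite Rintegral_set0.
Qed.

(** The second clause is only an upper bound because overlapping segments of opposite directions may
    cancel. *)
Lemma matching_current (s : seq (E * E)) : exists T : current1 R d,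
  [/\ forall f, boundary T f = \sum_(z <- s) (f z.2 - f z.1),
      forall w, (forall z, enorm (form1_at w z) <= 1) ->
        T w <= \sum_(z <- s) enorm (z.1 - z.2) &
      integer_rectifiable1 T].
Proof.
elim: s => [|[p q] s [T [bT Tle rT]]].
  have [T [T0 rT]] := current1_zero; exists T; split=> // [f|w _].
    by rewrite big_nil /= /boundary_fun T0.
  by rewrite big_nil T0.
(* A pair of equal points has no unit direction and contributes nothing to either sum. *)
have [pq|pq] := eqVneq p q.
  exists T; split=> // [f|w w1]; rewrite big_cons /= pq subrr.
    by rewrite add0r bT.
  by rewrite enorm0 add0r Tle.
pose l := enorm (q - p); pose v := l^-1 *: (q - p).
have l0 : 0 < l by rewrite lt_neqAle enorm_ge0 andbT eq_sym enorm_eq0 subr_eq0 eq_sym.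
have v1 : enorm v = 1.
  by rewrite enormZ ger0_norm ?invr_ge0 ?enorm_ge0// mulVf// gt_eqF.
have lineq : line p v l = q.
  by rewrite /line /v scalerA divff ?gt_eqF// scale1r addrC subrK.
have [U UE] := current1_add T (segment_current p v l0).
exists U; split.
- move=> f; rewrite big_cons /= -bT /= /boundary_fun UE addrC; congr (_ + _).
  by have := boundary_segment p v l0 f; rewrite lineq.
- move=> w w1; rewrite big_cons /= UE addrC; apply: lerD; last exact: Tle.
  by rewrite enormB; exact: segment_current_le.
- have [A [tau [theta [mA rA [oA mtau] itheta TE]]]] := rT.
  exact: (integer_rectifiable1_add_segment v1 mA rA oA mtau itheta TE UE).
Qed.

Lemma mass0_point_charge_lty (Nm Np : nat) (a : 'I_Nm -> nat) (x : 'I_Nm -> E)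
    (b : 'I_Np -> nat) (y : 'I_Np -> E) (B : current0 R d) :
  (forall f : testfun R d, B f =
     - (\sum_(i < Nm) (a i)%:R * f (x i)) + \sum_(j < Np) (b j)%:R * f (y j)) ->
  (mass0 B < +oo)%E.
Proof.
move=> BE.
apply: (@le_lt_trans _ _ (\sum_(i < Nm) (a i)%:R + \sum_(j < Np) (b j)%:R)%:E);
  last exact: ltry.
apply: ge_ereal_sup => _ [f /= f1 <-]; rewrite lee_fin BE -sumrN.
apply: lerD; apply: ler_sum => i _; rewrite -?mulrN ler_piMr//.
  by rewrite lerNl; have := f1 (x i); rewrite ler_norml => /andP[].
by have := f1 (y i); rewrite ler_norml => /andP[].
Qed.

Lemma repeat_points n (a : 'I_n -> nat) (x : 'I_n -> E) :
  exists2 s : seq E, size s = (\sum_i a i)%N &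
    forall f : E -> R, \sum_(z <- s) f z = \sum_i (a i)%:R * f (x i).
Proof.
exists (flatten [seq nseq (a i) (x i) | i <- enum 'I_n]).
  rewrite size_flatten /shape -map_comp sumnE big_map big_enum /=.
  by apply: eq_bigr => i _; rewrite size_nseq.
move=> f; rewrite big_flatten big_map big_enum /=; apply: eq_bigr => i _.
by rewrite big_nseq iter_addr_0 mulr_natl.
Qed.

End OptimalCurrent.

Theorem proposition4p3 (R : realType) (d Nm Np : nat)
  (a : 'I_Nm -> nat) (x : 'I_Nm -> 'rV[R]_d)
  (b : 'I_Np -> nat) (y : 'I_Np -> 'rV[R]_d)
  (B0 : current0 R d)
  (B0E : forall f : testfun R d,
     B0 f = - (\sum_(i < Nm) (a i)%:R * delta (x i) f)
            + \sum_(j < Np) (b j)%:R * delta (y j) f)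
  (B0_boundary : exists S : current1 R d, integral_current S /\ boundary S = B0) :
  [/\ normal_masses B0 (M_R B0),
      integral_masses B0 (M_Z B0) &
      M_R B0 = M_Z B0].
Proof.
have [S [[rS rB0] bS]] := B0_boundary; rewrite bS in rB0.
have ab : (\sum_i a i = \sum_j b j)%N.
  apply: (boundary_neutral (x := x) (y := y) (integer_rectifiable1_mass rS)) => f.
  by rewrite bS; exact: B0E.
have [sx sizex sxE] := repeat_points a x; have [sy sizey syE] := repeat_points b y.
pose n := size sx; have nE : size sy = n by rewrite sizey -ab -sizex.
pose p (i : 'I_n) : 'rV[R]_d := nth 0 sx i.
pose q (i : 'I_n) : 'rV[R]_d := nth 0 sy i.
have [s smin] := exists_min_perm (fun i j => enorm (p i - q j)).
(* Relabelling the sinks makes the identity an optimal matching, the form that the duality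
   expects. *)
pose q' i := q (s i).
have B0pq (f : testfun R d) : B0 f = \sum_i (f (q' i) - f (p i)).
  rewrite B0E sumrB addrC; congr (_ - _).
    transitivity (\sum_(z <- sy) f z); first by rewrite syE.
    by rewrite (big_nth 0) nE big_mkord (reindex_inj (@perm_inj _ s)).
  transitivity (\sum_(z <- sx) f z); first by rewrite sxE.
  by rewrite (big_nth 0) big_mkord.
have pq_min (t : 'S_n) : \sum_i enorm (p i - q' i) <= \sum_i enorm (p i - q' (t i)).
  apply: le_trans (smin (t * s)%g) _.
  by apply: ler_sum => i _; rewrite permM.
have [T [bT Tle rT]] := matching_current [seq (p i, q' i) | i <- enum 'I_n].
have bTB0 : boundary T = B0.
  by apply: current0_ext => f; rewrite bT B0pq big_map big_enum.
pose W := (\sum_i enorm (p i - q' i))%:E.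
have lowerW (U : current1 R d) : boundary U = B0 -> (W <= mass1 U)%E.
  by move=> bU; apply: min_matching_le_mass => // f; rewrite bU B0pq.
(* The lower bound applies to [T] itself, so an optimal matching undergoes no cancellation. *)
have TW : mass1 T = W.
  apply/eqP; rewrite eq_le lowerW// andbT.
  apply: ge_ereal_sup => _ [w /= w1 <-]; rewrite lee_fin.
  by have := Tle w w1; rewrite big_map big_enum.
have nT : normal_masses B0 W.
  exists T => //; split=> //; rewrite /normal TW bTB0 lte_add_pinfty ?ltry//.
  exact: mass0_point_charge_lty B0E.
have iT : integral_masses B0 W.
  by exists T => //; split=> //; split=> //; rewrite bTB0.
have MR : M_R B0 = W.
  apply/eqP; rewrite eq_le ereal_inf_lbound//=.
  by apply: le_ereal_inf_tmp => _ [U [_ bU] <-]; exact: lowerW.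
have MZ : M_Z B0 = W.
  apply/eqP; rewrite eq_le ereal_inf_lbound//=.
  by apply: le_ereal_inf_tmp => _ [U [_ bU] <-]; exact: lowerW.
by rewrite MR MZ.
Qed.
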